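(* Let $k$ be a field and let $A$ be a finite dimensional $k$-algebra or a commutative $k$-algebra essentially of finite type. Assume that for every simple $A$-module $V$, the center $Z(\operatorname{End}_A(V))$ is a separable extension of $k$. If $A$ has finite global dimension, then $$D^b(A)=\langle\widetilde{A}\rangle_{1+\operatorname{gldim}A}\qquad\text{and}\qquad D^b(A\text{-mod})=\langle A\rangle_{1+\operatorname{gldim}A}.$$ In particular, $\dim D^b(A\text{-mod})\le\operatorname{gldim}A$.
   Context: A commutative $k$-algebra is essentially of finite type if it is a localization of a commutative $k$-algebra of finite type over $k$. $A\text{-mod}$ is the category of finitely generated left $A$-modules; $D^b(A)$ is the bounded derived category of the category of all left $A$-modules; $\operatorname{gldim}A$ is the global dimension of $A$. Let $\mathcal{T}$ be a triangulated category and $\mathcal{I}$ a subcategory (or an object) of $\mathcal{T}$. - $\langle\mathcal{I}\rangle$ is the smallest full subcategory of $\mathcal{T}$ containing $\mathcal{I}$ and closed under finite direct sums, direct summands and shifts. - $\widetilde{\mathcal{I}}$ is the smallest full subcategory of $\mathcal{T}$ closed under finite direct sums and shifts and containing all multiples of objects of $\mathcal{I}$, i.e. for $Y\in\mathcal{I}$ and a set $S$ such that the direct sum $Y^{(S)}$ exists in $\mathcal{T}$, one has $Y^{(S)}\in\widetilde{\mathcal{I}}$. - $\mathcal{I}_1*\mathcal{I}_2$ is the full subcategory of objects $M$ for which there is a distinguished triangle $M_1\to M\to M_2\to M_1[1]$ with $M_i\in\mathcal{I}_i$, and $\mathcal{I}_1\diamond\mathcal{I}_2=\langle\mathcal{I}_1*\mathcal{I}_2\rangle$.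 - $\langle\mathcal{I}\rangle_0=0$ and $\langle\mathcal{I}\rangle_i=\langle\mathcal{I}\rangle_{i-1}\diamond\langle\mathcal{I}\rangle$ for $i\ge1$. - $\dim\mathcal{T}$ is the minimal integer $d\ge0$ such that there is $M\in\mathcal{T}$ with $\mathcal{T}=\langle M\rangle_{d+1}$ (and $\infty$ if there is none). In each equality the construction is carried out in the triangulated category on the left-hand side. *)

(* Defs.v *)
From HB Require Import structures.
From mathcomp Require Import all_boot all_algebra.
From mathcomp Require Import separable.
From mathcomp Require Import boolp zify.
From mathcomp Require Import mpoly.

Set Implicit Arguments.
Unset Strict Implicit.
Unset Printing Implicit Defensive.

Import GRing.Theory.
Local Open Scope ring_scope.

(* [None] stands for infinity. *)
Definition inf_nat (P : nat -> Prop) : option nat :=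
  if pselect (exists n, `[< P n >]) is left h then Some (ex_minn h) else None.

Definition enat_le (x y : option nat) : Prop :=
  match x, y with
  | _, None => True
  | None, Some _ => False
  | Some m, Some n => (m <= n)%N
  end.

(* Hom-sets are setoids: [heq] is equality of morphisms. *)
Record category := Category {
  ob :> Type;
  hom : ob -> ob -> Type;
  heq : forall X Y, hom X Y -> hom X Y -> Prop;
  idm : forall X, hom X X;
  (* diagrammatic order: [comp f g] is "f, then g" *)
  comp : forall X Y Z, hom X Y -> hom Y Z -> hom X Z;
  heq_refl : forall X Y (f : hom X Y), heq f f;
  heq_sym : forall X Y (f g : hom X Y), heq f g -> heq g f;
  heq_trans : forall X Y (f g h : hom X Y), heq f g -> heq g h -> heq f h;
  comp_heq : forall X Y Z (f f' : hom X Y) (g g' : hom Y Z),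
    heq f f' -> heq g g' -> heq (comp f g) (comp f' g');
  comp_idl : forall X Y (f : hom X Y), heq (comp (idm X) f) f;
  comp_idr : forall X Y (f : hom X Y), heq (comp f (idm Y)) f;
  compA : forall X Y Z U (f : hom X Y) (g : hom Y Z) (h : hom Z U),
    heq (comp f (comp g h)) (comp (comp f g) h)
}.

Arguments hom {c} X Y.
Arguments heq {c X Y} f g.
Arguments idm {c} X.
Arguments comp {c X Y Z} f g.

Definition is_iso (C : category) (X Y : C) (f : hom X Y) : Prop :=
  exists g : hom Y X, heq (comp f g) (idm X) /\ heq (comp g f) (idm Y).

Definition is_coproduct (C : category) (S : Type) (F : S -> C) (Z : C)
    (i : forall s, hom (F s) Z) : Prop :=
  forall (U : C) (g : forall s, hom (F s) U),
    exists h : hom Z U, (forall s, heq (comp (i s) h) (g s)) /\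
      (forall h' : hom Z U, (forall s, heq (comp (i s) h') (g s)) -> heq h' h).

Definition is_direct_sum (C : category) (S : Type) (F : S -> C) (Z : C) : Prop :=
  exists i : forall s, hom (F s) Z, is_coproduct i.

Definition is_zero (C : category) (Z : C) : Prop :=
  forall X : C,
    (exists f : hom Z X, forall f', heq f' f) /\
    (exists g : hom X Z, forall g', heq g' g).

(* The localization C[W^-1] of Gabriel and Zisman: morphisms are words in
   morphisms of [C] and formal inverses of morphisms in [W], modulo the relations
   [zigzag_eq]. *)

Section Localization.

Variables (C : category) (W : forall X Y : C, hom X Y -> Prop).

Inductive zigzag : C -> C -> Type :=
| zfwd X Y (f : hom X Y) : zigzag X Y
| zinv X Y (f : hom X Y) (Wf : W f) : zigzag Y X
| zcomp X Y Z (p : zigzag X Y) (q : zigzag Y Z) : zigzag X Z.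

Inductive zigzag_eq : forall X Y : C, zigzag X Y -> zigzag X Y -> Prop :=
| zeq_refl X Y (p : zigzag X Y) : zigzag_eq p p
| zeq_sym X Y (p q : zigzag X Y) : zigzag_eq p q -> zigzag_eq q p
| zeq_trans X Y (p q r : zigzag X Y) :
    zigzag_eq p q -> zigzag_eq q r -> zigzag_eq p r
| zeq_comp X Y Z (p p' : zigzag X Y) (q q' : zigzag Y Z) :
    zigzag_eq p p' -> zigzag_eq q q' -> zigzag_eq (zcomp p q) (zcomp p' q')
| zeq_compA X Y Z U (p : zigzag X Y) (q : zigzag Y Z) (r : zigzag Z U) :
    zigzag_eq (zcomp p (zcomp q r)) (zcomp (zcomp p q) r)
| zeq_idl X Y (p : zigzag X Y) : zigzag_eq (zcomp (zfwd (idm X)) p) p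
| zeq_idr X Y (p : zigzag X Y) : zigzag_eq (zcomp p (zfwd (idm Y))) p
| zeq_fwd X Y (f g : hom X Y) : heq f g -> zigzag_eq (zfwd f) (zfwd g)
| zeq_fwd_comp X Y Z (f : hom X Y) (g : hom Y Z) :
    zigzag_eq (zfwd (comp f g)) (zcomp (zfwd f) (zfwd g))
| zeq_invr X Y (f : hom X Y) (Wf : W f) :
    zigzag_eq (zcomp (zfwd f) (zinv Wf)) (zfwd (idm X))
| zeq_invl X Y (f : hom X Y) (Wf : W f) :
    zigzag_eq (zcomp (zinv Wf) (zfwd f)) (zfwd (idm Y)).

Definition localization : category :=
  @Category C zigzag zigzag_eq (fun X => zfwd (idm X)) zcomp
    zeq_refl zeq_sym zeq_trans zeq_comp zeq_idl zeq_idr zeq_compA.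

End Localization.

(* Only the data of a triangulated category (shift functor and class of
   distinguished triangles): the notions below do not involve the axioms.
   Likewise the additive structure enters only through finite direct sums, which
   in an additive category are the finite coproducts. *)
Record triangulated_data := TriangulatedData {
  tcat :> category;
  shift : tcat -> tcat;
  shiftm : forall X Y : tcat, hom X Y -> hom (shift X) (shift Y);
  shiftm_heq : forall (X Y : tcat) (f g : hom X Y),
    heq f g -> heq (shiftm f) (shiftm g);
  shiftm_id : forall X : tcat, heq (shiftm (idm X)) (idm (shift X));
  shiftm_comp : forall (X Y Z : tcat) (f : hom X Y) (g : hom Y Z),
    heq (shiftm (comp f g)) (comp (shiftm f) (shiftm g));
  distinguished : forall X Y Z : tcat,
    hom X Y -> hom Y Z -> hom Z (shift X) -> Prop
}.

Arguments shift {t} X.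
Arguments shiftm {t X Y} f.
Arguments distinguished {t X Y Z} u v w.

Section Generation.

Variable T : triangulated_data.
Implicit Types (I : T -> Prop) (X Y Z M : T).

(* Closure under direct sums of one-element families is closure under
   isomorphism, and the empty direct sums are the zero objects. *)
Inductive span I : T -> Prop :=
| span_in X : I X -> span I X
| span_sum n (F : 'I_n -> T) Z :
    (forall s, span I (F s)) -> is_direct_sum F Z -> span I Z
| span_summand X Y Z :
    span I Z -> is_direct_sum (fun b : bool => if b then X else Y) Z -> span I X
| span_shift X : span I X -> span I (shift X)
| span_unshift X : span I (shift X) -> span I X.

Inductive multiples I : T -> Prop :=
| multiples_in (S : Type) Y Z :
    I Y -> is_direct_sum (fun _ : S => Y) Z -> multiples I Z
| multiples_sum n (F : 'I_n -> T) Z :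
    (forall s, multiples I (F s)) -> is_direct_sum F Z -> multiples I Z
| multiples_shift X : multiples I X -> multiples I (shift X)
| multiples_unshift X : multiples I (shift X) -> multiples I X.

Definition star I1 I2 : T -> Prop := fun M =>
  exists (M1 M2 : T) (u : hom M1 M) (v : hom M M2) (w : hom M2 (shift M1)),
    [/\ I1 M1, I2 M2 & distinguished u v w].

Definition diamond I1 I2 : T -> Prop := span (star I1 I2).

Fixpoint span_iter I (i : nat) : T -> Prop :=
  if i is j.+1 then diamond (span_iter I j) (span I) else @is_zero T.

Definition single M : T -> Prop := fun X => X = M.

Definition tri_dim : option nat :=
  inf_nat (fun d => exists M, forall X, span_iter (single M) d.+1 X).

End Generation.

Definition mklinear (A : pzRingType) (U V : lmodType A) (f : U -> V)
    (fL : linear f) : {linear U -> V} :=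
  HB.pack f (GRing.isLinear.Build A U V *:%R f fL).

Definition finitely_generated (A : pzRingType) (M : lmodType A) : Prop :=
  exists (n : nat) (e : 'I_n -> M),
    forall x : M, exists a : 'I_n -> A, x = \sum_(i < n) a i *: e i.

Definition is_projective (A : pzRingType) (P : lmodType A) : Prop :=
  forall (M N : lmodType A) (p : {linear M -> N}) (f : {linear P -> N}),
    (forall y, exists x, p x = y) ->
    exists g : {linear P -> M}, forall x, p (g x) = f x.

(* There is an exact sequence 0 -> P_n -> ... -> P_0 -> M -> 0 with all P_i
   projective. *)
Definition has_projective_resolution (A : pzRingType) (M : lmodType A)
    (n : nat) : Prop :=
  exists (P : nat -> lmodType A) (d : forall i, {linear P i.+1 -> P i})
         (e : {linear P 0%N -> M}),
    [/\ forall i, is_projective (P i),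
        forall i, (n < i)%N -> forall x : P i, x = 0,
        forall y, exists x, e x = y,
        forall x, e x = 0 <-> exists x', d 0%N x' = x &
        forall i (x : P i.+1), d i x = 0 <-> exists x', d i.+1 x' = x].

Definition proj_dim (A : pzRingType) (M : lmodType A) : option nat :=
  inf_nat (has_projective_resolution M).

(* The supremum of the projective dimensions of all left modules. *)
Definition gldim (A : pzRingType) : option nat :=
  inf_nat (fun n => forall M : lmodType A, enat_le (proj_dim M) (Some n)).

Definition is_simple (A : pzRingType) (V : lmodType A) : Prop :=
  (exists v : V, v <> 0) /\
  forall N : V -> Prop,
    N 0 -> (forall x y, N x -> N y -> N (x + y)) ->
    (forall (a : A) x, N x -> N (a *: x)) ->
    (forall x, N x -> x = 0) \/ (forall x, N x).

Section Complexes.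

Variable A : pzRingType.

Record complex := Complex {
  cob :> int -> lmodType A;
  cd : forall n, {linear cob n -> cob (n + 1)};
  cdd : forall n (x : cob n), cd (n + 1) (cd n x) = 0
}.

Arguments cd {c} n : rename.

Record chain_map (X Y : complex) := ChainMap {
  cmap :> forall n, {linear X n -> Y n};
  cmap_d : forall n (x : X n), cd n (cmap n x) = cmap (n + 1) (cd n x)
}.

Lemma id_cmap_d (X : complex) n (x : X n) : cd n x = cd n x.
Proof. by []. Qed.

Definition id_map (X : complex) : chain_map X X :=
  @ChainMap X X (fun n => idfun) (@id_cmap_d X).

Lemma comp_cmap_d (X Y Z : complex) (f : chain_map X Y) (g : chain_map Y Z) n
  (x : X n) : cd n (g n (f n x)) = g (n + 1) (f (n + 1) (cd n x)).
Proof. by rewrite !cmap_d. Qed.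

Definition comp_map (X Y Z : complex) (f : chain_map X Y) (g : chain_map Y Z) :
    chain_map X Z :=
  @ChainMap X Z (fun n => g n \o f n) (comp_cmap_d f g).

(* The map induced on the cohomology in degree n + 1 is bijective for all n; as n
   ranges over the integers, so does n + 1. *)
Definition quasi_iso (X Y : complex) (f : chain_map X Y) : Prop :=
  forall n : int,
    (forall x : X (n + 1), cd (n + 1) x = 0 ->
       (exists y, f (n + 1) x = cd n y) -> exists x', x = cd n x') /\
    (forall y : Y (n + 1), cd (n + 1) y = 0 ->
       exists x : X (n + 1), cd (n + 1) x = 0 /\
         exists y', y = f (n + 1) x + cd n y').

Lemma oppd_linear (X : complex) n : linear (fun x : X (n + 1) => - cd (n + 1) x).
Proof. by move=> a x y; rewrite linearP opprD scalerN. Qed.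

Lemma shift_dd (X : complex) n (x : X (n + 1)) :
  mklinear (@oppd_linear X (n + 1)) (mklinear (@oppd_linear X n) x) = 0.
Proof. by rewrite /= linearN cdd !oppr0. Qed.

Definition shift_complex (X : complex) : complex :=
  @Complex (fun n => X (n + 1)) (fun n => mklinear (@oppd_linear X n))
    (@shift_dd X).

Lemma shift_cmap_d (X Y : complex) (f : chain_map X Y) n (x : X (n + 1)) :
  mklinear (@oppd_linear Y n) (f (n + 1) x) =
  f (n + 1 + 1) (mklinear (@oppd_linear X n) x).
Proof. by rewrite /= linearN cmap_d. Qed.

Definition shift_map (X Y : complex) (f : chain_map X Y) :
    chain_map (shift_complex X) (shift_complex Y) :=
  @ChainMap (shift_complex X) (shift_complex Y) (fun n => f (n + 1))
    (shift_cmap_d f).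

Lemma shift_quasi_iso (X Y : complex) (f : chain_map X Y) :
  quasi_iso f -> quasi_iso (shift_map f).
Proof.
move=> qf n; have [fi fs] := qf (n + 1); split=> /= [x /eqP | y /eqP].
- rewrite oppr_eq0 => /eqP dx0 [y fxy].
  have [|x' ->] := fi x dx0; first by exists (- y); rewrite linearN.
  by exists (- x'); rewrite linearN opprK.
- rewrite oppr_eq0 => /eqP dy0; have [x [dx0 [y' ->]]] := fs y dy0.
  exists x; split; first by rewrite dx0 oppr0.
  by exists (- y'); rewrite linearN opprK.
Qed.

Section Cone.

Variables (X Y : complex) (f : chain_map X Y).

Definition cone_ob (n : int) : lmodType A := (X (n + 1)%R * Y n)%type.

Definition cone_d (n : int) (p : cone_ob n) : cone_ob (n + 1) :=
  (- cd (n + 1) p.1, f (n + 1) p.1 + cd n p.2).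

Lemma cone_d_linear n : linear (@cone_d n).
Proof.
move=> a x y; apply: injective_projections => /=.
  by rewrite linearP opprD scalerN.
by rewrite !linearP /= scalerDr addrACA.
Qed.

Lemma cone_dd n (p : cone_ob n) :
  mklinear (@cone_d_linear (n + 1)) (mklinear (@cone_d_linear n) p) = 0.
Proof.
apply: injective_projections => /=.
  by rewrite linearN cdd !oppr0.
by rewrite linearD cdd addr0 cmap_d linearN addNr.
Qed.

Definition cone : complex :=
  @Complex cone_ob (fun n => mklinear (@cone_d_linear n)) cone_dd.

Lemma cone_in_linear n : linear (fun y : Y n => (0, y) : cone n).
Proof.
by move=> a x y; apply: injective_projections; rewrite //= scaler0 addr0.
Qed.

Lemma cone_in_d n (y : Y n) :
  @cd cone n (mklinear (@cone_in_linear n) y) =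
  mklinear (@cone_in_linear (n + 1)) (cd n y).
Proof.
by apply: injective_projections => /=; rewrite linear0 ?oppr0 ?add0r.
Qed.

Definition cone_in : chain_map Y cone :=
  @ChainMap Y cone (fun n => mklinear (@cone_in_linear n)) cone_in_d.

Lemma cone_out_linear n : linear (fun p : cone n => p.1 : shift_complex X n).
Proof. by []. Qed.

Lemma cone_out_d n (p : cone n) :
  @cd (shift_complex X) n (mklinear (@cone_out_linear n) p) =
  mklinear (@cone_out_linear (n + 1)) (@cd cone n p).
Proof. by []. Qed.

Definition cone_out : chain_map cone (shift_complex X) :=
  @ChainMap cone (shift_complex X) (fun n => mklinear (@cone_out_linear n))
    cone_out_d.

End Cone.

Definition stalk_ob (M : lmodType A) (n : int) : lmodType A :=
  if n is Posz 0 then M else 'rV[A]_0.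

Lemma stalk_dd (M : lmodType A) n (x : stalk_ob M n) :
  (\0 : stalk_ob M (n + 1) -> stalk_ob M (n + 1 + 1))
    ((\0 : stalk_ob M n -> stalk_ob M (n + 1)) x) = 0.
Proof. by []. Qed.

Definition stalk (M : lmodType A) : complex :=
  @Complex (stalk_ob M) (fun n => \0) (@stalk_dd M).

Definition is_bounded (X : complex) : Prop :=
  exists N : nat, forall n : int, (N < absz n)%N -> forall x : X n, x = 0.

End Complexes.

Arguments cd {A c} n : rename.

(* An additive full subcategory of the category of left modules; [Db] below is
   the localization of its bounded complexes at quasi-isomorphisms. *)
Record module_class (A : pzRingType) := ModuleClass {
  in_class :> lmodType A -> Prop;
  in_class0 : in_class 'rV[A]_0;
  in_classD : forall M N : lmodType A,
    in_class M -> in_class N -> in_class (M * N)%type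
}.

Definition all_modules (A : pzRingType) : module_class A :=
  @ModuleClass A (fun _ => True) I (fun _ _ _ _ => I).

Lemma fg_zero (A : pzRingType) : @finitely_generated A 'rV[A]_0.
Proof.
exists 0%N, (fun _ => 0) => x; exists (fun _ => 0).
by rewrite big_ord0 [x]thinmx0.
Qed.

Lemma fg_prod (A : pzRingType) (M N : lmodType A) :
  finitely_generated M -> finitely_generated N ->
  finitely_generated (M * N)%type.
Proof.
move=> [m [e He]] [n [f Hf]].
exists (m + n)%N, (fun i => match split i with
  | inl j => (e j, 0) | inr j => (0, f j) end) => -[x y].
have [a ->] := He x; have [b ->] := Hf y.
exists (fun i => match split i with inl j => a j | inr j => b j end).
have Sl i : split (lshift n i) = inl i :> 'I_m + 'I_n.
  exact: (unsplitK (inl i)).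
have Sr i : split (rshift m i) = inr i :> 'I_m + 'I_n.
  exact: (unsplitK (inr i)).
transitivity (\sum_(i < m) a i *: ((e i, 0) : M * N) +
              \sum_(i < n) b i *: ((0, f i) : M * N)); last first.
  rewrite big_split_ord; congr (_ + _); apply: eq_bigr => i _.
    by rewrite Sl.
  by rewrite Sr.
apply: injective_projections; rewrite /= !raddf_sum /=.
  rewrite [X in _ + X]big1 ?addr0 // => i _; exact: scaler0.
rewrite [X in X + _]big1 ?add0r // => i _; exact: scaler0.
Qed.

Definition fg_modules (A : pzRingType) : module_class A :=
  @ModuleClass A (@finitely_generated A) (fg_zero A) (@fg_prod A).

Section BoundedDerivedCategory.

Variables (A : pzRingType) (P : module_class A).

Record bounded_complex := BoundedComplex {
  bc :> complex A;
  bc_bounded : is_bounded bc;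
  bc_class : forall n, P (bc n)
}.

Lemma bounded_shift (X : bounded_complex) : is_bounded (shift_complex X).
Proof.
have [N XN] := bc_bounded X; exists N.+1 => n Nn x; apply: XN; lia.
Qed.

Definition bshift (X : bounded_complex) : bounded_complex :=
  @BoundedComplex (shift_complex X) (bounded_shift X)
    (fun n => bc_class X (n + 1)).

Lemma bounded_cone (X Y : bounded_complex) (f : chain_map X Y) :
  is_bounded (cone f).
Proof.
have [N XN] := bc_bounded X; have [N' YN] := bc_bounded Y.
exists (N + N').+1 => n Nn [x y].
by congr (_, _); [apply: XN | apply: YN]; lia.
Qed.

Definition bcone (X Y : bounded_complex) (f : chain_map X Y) : bounded_complex :=
  @BoundedComplex (cone f) (bounded_cone f)
    (fun n => in_classD (bc_class X (n + 1)) (bc_class Y n)).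

Lemma bounded_stalk (M : lmodType A) : is_bounded (stalk M).
Proof.
exists 0%N => -[[|n]|n] //= _ x; exact: thinmx0.
Qed.

Lemma stalk_class (M : lmodType A) : P M -> forall n, P (stalk M n).
Proof. by move=> PM [[|n]|n] //=; exact: in_class0. Qed.

Definition bstalk (M : lmodType A) (PM : P M) : bounded_complex :=
  @BoundedComplex (stalk M) (bounded_stalk M) (stalk_class PM).

Definition chain_eq (X Y : bounded_complex) (f g : chain_map X Y) : Prop :=
  forall n (x : X n), f n x = g n x.

Definition bounded_complexes : category.
Proof.
refine (@Category bounded_complex (fun X Y => chain_map X Y) chain_eq
          (fun X => id_map X) (fun X Y Z f g => comp_map f g) _ _ _ _ _ _ _) => //.
- by move=> X Y f g fg n x; rewrite fg.
- by move=> X Y f g h fg gh n x; rewrite fg.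
- by move=> X Y Z f f' g g' ff gg n x; rewrite /= ff gg.
Defined.

Definition bquasi_iso (X Y : bounded_complexes) (f : hom X Y) : Prop :=
  quasi_iso (f : chain_map X Y).

Definition Db_cat : category := localization bquasi_iso.

Definition quot_map (X Y : bounded_complexes) (f : chain_map X Y) :
    @hom Db_cat X Y :=
  zfwd bquasi_iso (f : @hom bounded_complexes X Y).

Fixpoint zigzag_shift (X Y : bounded_complexes) (p : zigzag bquasi_iso X Y) :
    zigzag bquasi_iso (bshift X) (bshift Y) :=
  match p in zigzag _ X Y return zigzag bquasi_iso (bshift X) (bshift Y) with
  | zfwd X Y f => @zfwd _ bquasi_iso (bshift X) (bshift Y) (shift_map f)
  | zinv X Y f qf =>
      @zinv _ bquasi_iso (bshift X) (bshift Y) (shift_map f) (shift_quasi_iso qf)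
  | zcomp X Y Z p q => zcomp (zigzag_shift p) (zigzag_shift q)
  end.

Lemma zigzag_shift_eq (X Y : bounded_complexes) (p q : zigzag bquasi_iso X Y) :
  zigzag_eq p q -> zigzag_eq (zigzag_shift p) (zigzag_shift q).
Proof.
have fid Z : zigzag_eq
    (@zfwd _ bquasi_iso (bshift Z) (bshift Z) (shift_map (id_map Z)))
    (zfwd bquasi_iso (@idm bounded_complexes (bshift Z))).
  by apply: zeq_fwd => n x.
elim=> {X Y p q} /=.
- by move=> X Y p; exact: zeq_refl.
- by move=> X Y p q _ ?; exact: zeq_sym.
- by move=> X Y p q r _ pq _ qr; exact: zeq_trans pq qr.
- by move=> X Y Z p p' q q' _ ? _ ?; exact: zeq_comp.
- by move=> *; exact: zeq_compA.
- move=> X Y p; apply: zeq_trans (zeq_idl _).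
  by apply: zeq_comp (zeq_refl _); exact: fid.
- move=> X Y p; apply: zeq_trans (zeq_idr _).
  by apply: zeq_comp (zeq_refl _) _; exact: fid.
- by move=> X Y f g fg; apply: zeq_fwd => n x; exact: fg.
- move=> X Y Z f g; apply: zeq_trans (zeq_fwd_comp _ _ _).
  by apply: zeq_fwd => n x.
- by move=> X Y f Wf; apply: zeq_trans (zeq_invr _) _; apply: zeq_sym; exact: fid.
- by move=> X Y f Wf; apply: zeq_trans (zeq_invl _) _; apply: zeq_sym; exact: fid.
Qed.

(* Triangles isomorphic in the derived category to a mapping cone triangle
   X0 -> Y0 -> cone f -> X0[1]. *)
Definition Db_distinguished (X Y Z : Db_cat)
    (u : hom X Y) (v : hom Y Z) (w : @hom Db_cat Z (bshift X)) : Prop :=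
  exists (X0 Y0 : bounded_complex) (f : chain_map X0 Y0)
      (a : @hom Db_cat X X0) (b : @hom Db_cat Y Y0) (c : @hom Db_cat Z (bcone f)),
    [/\ [/\ is_iso a, is_iso b & is_iso c],
        heq (comp u b) (comp a (@quot_map X0 Y0 f)),
        heq (comp v c) (comp b (@quot_map Y0 (bcone f) (cone_in f))) &
        heq (comp w (zigzag_shift a : @hom Db_cat (bshift X) (bshift X0)))
            (comp c (@quot_map (bcone f) (bshift X0) (cone_out f)))].

Lemma zigzag_shift_id (X : Db_cat) :
  zigzag_eq (zigzag_shift (@idm Db_cat X)) (@idm Db_cat (bshift X)).
Proof. by apply: zeq_fwd => n x. Qed.

Definition Db : triangulated_data :=
  @TriangulatedData Db_cat bshift zigzag_shift zigzag_shift_eq zigzag_shift_id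
    (fun X Y Z p q => zeq_refl _) Db_distinguished.

End BoundedDerivedCategory.

Lemma fg_regular (A : pzRingType) : @finitely_generated A A^o.
Proof.
exists 1%N, (fun _ => 1) => x; exists (fun _ => x).
by rewrite big_ord1 /GRing.scale /= mulr1.
Qed.

Definition Db_Mod (A : pzRingType) : triangulated_data := Db (all_modules A).

Definition Db_mod (A : pzRingType) : triangulated_data := Db (fg_modules A).

Definition reg_Mod (A : pzRingType) : Db_Mod A :=
  @bstalk A (all_modules A) A^o I.

Definition reg_mod (A : pzRingType) : Db_mod A :=
  @bstalk A (fg_modules A) A^o (fg_regular A).

(* A k-algebra is a ring with a central ring morphism [iota] from k; unlike
   [algType], this allows the zero algebra. *)
Definition central_map (k A : pzRingType) (iota : k -> A) : Prop :=
  forall c a, iota c * a = a * iota c.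

Definition finite_dimensional (k : fieldType) (A : pzRingType)
    (iota : {rmorphism k -> A}) : Prop :=
  exists (n : nat) (e : 'I_n -> A),
    forall x : A, exists c : 'I_n -> k, x = \sum_(i < n) iota (c i) * e i.

Definition finite_type (k : fieldType) (B : comPzRingType)
    (beta : {rmorphism k -> B}) : Prop :=
  exists s : seq B, forall Q : B -> Prop,
    (forall c, Q (beta c)) ->
    (forall x y, Q x -> Q y -> Q (x + y)) ->
    (forall x y, Q x -> Q y -> Q (x * y)) ->
    (forall x, x \in s -> Q x) -> forall x, Q x.

Definition multiplicative_set (B : comPzRingType) (S : B -> Prop) : Prop :=
  S 1 /\ forall x y, S x -> S y -> S (x * y).

(* [phi] identifies [A] with the ring of fractions of [B] with denominators
   in [S]. *)
Definition is_localization (B : comPzRingType) (A : pzRingType) (S : B -> Prop)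
    (phi : {rmorphism B -> A}) : Prop :=
  [/\ forall s, S s -> exists a, phi s * a = 1,
      forall a, exists b s, S s /\ a * phi s = phi b &
      forall b b', phi b = phi b' -> exists s, S s /\ s * b = s * b'].

Definition commutative_ring (A : pzRingType) : Prop :=
  forall x y : A, x * y = y * x.

Definition essentially_finite_type (k : fieldType) (A : pzRingType)
    (iota : {rmorphism k -> A}) : Prop :=
  exists (B : comPzRingType) (beta : {rmorphism k -> B})
      (phi : {rmorphism B -> A}) (S : B -> Prop),
    [/\ finite_type beta, multiplicative_set S, is_localization S phi &
        forall c, phi (beta c) = iota c].

Section Separable.

Variables (k K : fieldType) (j : {rmorphism k -> K}).

(* The subfield k(S) of K. *)
Definition adjoin (S : K -> Prop) : K -> Prop := fun z =>
  forall F : K -> Prop,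
    (forall c, F (j c)) -> (forall x y, F x -> F y -> F (x - y)) ->
    (forall x y, F x -> F y -> F (x / y)) ->
    (forall x, S x -> F x) -> F z.

Definition separable_over (F : K -> Prop) (z : K) : Prop :=
  exists p : {poly K},
    [/\ forall i, F p`_i, separable_poly p & root p z].

Definition algebraically_independent (n : nat) (t : 'I_n -> K) : Prop :=
  forall p : {mpoly k[n]}, mmap j t p = 0 -> p = 0.

(* The subfield [L] of K is separable algebraic over some k(t), where t is a
   transcendence basis of L over k. *)
Definition separably_generated (L : K -> Prop) : Prop :=
  exists (n : nat) (t : 'I_n -> K),
    [/\ forall i, L (t i), algebraically_independent t &
        forall z, L z -> separable_over (adjoin (fun x => exists i, x = t i)) z].

(* K/k need not be algebraic: it is separable when every finitely generated
   subextension is separably generated (Stacks Project, Tag 030O). *)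
Definition separable_extension : Prop :=
  forall s : seq K, separably_generated (adjoin (fun x => x \in s)).

End Separable.

(* [theta] is an isomorphism of k-algebras from K onto the center of End_A(V). *)
Definition is_center_of_End (k : fieldType) (A : pzRingType)
    (iota : {rmorphism k -> A}) (V : lmodType A) (K : fieldType)
    (j : {rmorphism k -> K}) (theta : K -> {linear V -> V}) : Prop :=
  [/\ [/\ forall v, theta 1 v = v,
          forall x y v, theta (x + y) v = theta x v + theta y v &
          forall x y v, theta (x * y) v = theta x (theta y v)],
      forall c v, theta (j c) v = iota c *: v,
      forall x y, (forall v, theta x v = theta y v) -> x = y,
      forall x (g : {linear V -> V}) v, theta x (g v) = g (theta x v) &
      forall f : {linear V -> V},
        (forall (g : {linear V -> V}) v, f (g v) = g (f v)) ->
        exists x, forall v, theta x v = f v].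

Definition separable_center (k : fieldType) (A : pzRingType)
    (iota : {rmorphism k -> A}) (V : lmodType A) : Prop :=
  exists (K : fieldType) (j : {rmorphism k -> K}) (theta : K -> {linear V -> V}),
    is_center_of_End iota j theta /\ separable_extension j.

(* Main.v *)
From HB Require Import structures.
From mathcomp Require Import all_boot all_algebra.
From mathcomp Require Import boolp functions zify.
Require Import Defs.

Set Implicit Arguments.
Unset Strict Implicit.
Unset Printing Implicit Defensive.

Import GRing.Theory.
Local Open Scope ring_scope.

(** A bounded complex X is resolved in the derived category by graded projective
    modules, as a module is resolved by projective modules.

    Given a map f from F to X, choose in every degree a projective module with a
    linear map to the cycles of the cone of f that is onto in cohomology
    ([cohomology_cover]). These maps form a chain map g from a graded projective
    module Q, with zero differential, to the cone of f, and there is a complex F'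
    containing F with quotient Q and a map f' from F' to X whose cone is the cone of g
    ([attach], [attach_assoc]). The long exact sequence of g identifies the cohomology
    of the cone of f' with the kernel of the surjection from Q to the cohomology of
    the cone of f ([cone_cohomology]). One step therefore costs one extension by Q,
    and replaces the cohomology of the cone by its first syzygy. Start from F = 0: the
    cone of f then has the cohomology of X, all of whose syzygies of order the global
    dimension d are projective by Schanuel's lemma. In step d + 1 the cover can be
    chosen to be the cohomology itself, so that the next cone is acyclic, X is
    isomorphic to the last F', and X is reached from 0 by d + 1 extensions
    ([resolution_span]).

    It remains to see that a graded projective module Q lies in the span of A, or of
    the multiples of A. This asks for coproducts in a category of formal zigzags.
    Because projective modules lift through quasi-isomorphisms, every zigzag out of Q
    is equal to a chain map ([graded_zigzag]); homotopic chain maps are equal because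
    of the cylinder ([quot_map_homotopic]), and equal ones agree in cohomology
    ([quot_map_inj_cohomology]). Hence a coproduct of graded projective modules, taken
    degree by degree, is a coproduct in the derived category ([graded_coproduct]), and
    Q is a finite sum of shifts of direct summands of free modules.

    For finitely generated modules the argument takes place inside the class of such
    modules, which has to be closed under submodules, that is, A has to be left
    Noetherian. A finite-dimensional algebra is, and so is a localization of a finitely
    generated commutative algebra, by Hilbert's basis theorem
    ([noetherian_adjoined]). *)

(** * Submodules, quotients and linear relations *)

Section Submodules.

Variable A : pzRingType.

Definition is_submodule (M : lmodType A) (N : M -> Prop) : Prop :=
  N 0 /\ forall (a : A) x y, N x -> N y -> N (a *: x + y).

Section SubmoduleType.

Variables (M : lmodType A) (N : M -> Prop) (N_sub : is_submodule N).

(** The closure proof is an argument so that the module structure, which depends on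
    it, can be attached to the type. *)
Definition submodule_type & is_submodule N := {x : M | `[< N x >]}.

HB.instance Definition _ := SubChoice.on (submodule_type N_sub).

Lemma submodule_closed : GRing.submod_closed (fun x : M => `[< N x >]).
Proof.
split; first exact/asboolP/N_sub.1.
by move=> a x y /asboolP Nx /asboolP Ny; apply/asboolP; exact: N_sub.2.
Qed.

HB.instance Definition _ := GRing.SubChoice_isSubLmodule.Build A M _
  (submodule_type N_sub) submodule_closed.

Lemma submodule_exists : exists (K : lmodType A) (i : {linear K -> M}),
  injective i /\ forall x, N x <-> exists k, i k = x.
Proof.
exists (submodule_type N_sub), \val; split; first exact: val_inj.
move=> x; split=> [Nx | [[y /= /asboolP Ny] <-] //].
by exists (exist _ x (asboolT Nx)).
Qed.

End SubmoduleType.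

Section QuotientType.

Variables (M : lmodType A) (N : M -> Prop) (N_sub : is_submodule N).

Definition quot_mem & is_submodule N := fun x : M => `[< N x >].

HB.instance Definition _ := GRing.isSubmodClosed.Build A M
  (quot_mem N_sub) (submodule_closed N_sub).

Local Notation memN := (GRing.ZmodClosed.clone M (quot_mem N_sub) _).

Definition quotient_type := Quotient.quot memN.

HB.instance Definition _ := GRing.Zmodule.on quotient_type.

Local Notation Q := quotient_type.
Local Notation pi := (\pi_(Quotient.quot memN)%qT : M -> Q).

Lemma quot_pi_eq x y : (pi x = pi y) <-> N (x - y).
Proof.
split=> [e | Nxy].
  by apply/asboolP; have := Quotient.idealrBE memN x y; rewrite unfold_in => ->; apply/eqP.
by apply/eqP; rewrite -Quotient.idealrBE unfold_in; apply/asboolP.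
Qed.

Lemma quot_pi_add : {morph pi : x y / x + y}.
Proof. by move=> x y; rewrite Quotient.pi_add. Qed.

Definition quot_scale (a : A) (x : Q) : Q := pi (a *: repr x).

Lemma quot_pi_scale a x : quot_scale a (pi x) = pi (a *: x).
Proof.
apply/quot_pi_eq; rewrite -scalerBr -[_ *: _]addr0; apply: N_sub.2 N_sub.1.
by apply/quot_pi_eq; rewrite reprK.
Qed.

Lemma quot_pi_surj (x : Q) : exists y, pi y = x.
Proof. by exists (repr x); rewrite reprK. Qed.

Fact quot_scalerA a b x : quot_scale a (quot_scale b x) = quot_scale (a * b) x.
Proof. by have [y <-] := quot_pi_surj x; rewrite !quot_pi_scale scalerA. Qed.
Fact quot_scale1r : left_id 1 quot_scale.
Proof. by move=> x; have [y <-] := quot_pi_surj x; rewrite quot_pi_scale scale1r. Qed.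
Fact quot_scalerDr : right_distributive quot_scale +%R.
Proof.
move=> a x y; have [[x' <-] [y' <-]] := (quot_pi_surj x, quot_pi_surj y).
by rewrite -quot_pi_add !quot_pi_scale scalerDr quot_pi_add.
Qed.
Fact quot_scalerDl x : {morph quot_scale^~ x : a b / a + b}.
Proof.
move=> a b; have [y <-] := quot_pi_surj x.
by rewrite !quot_pi_scale scalerDl quot_pi_add.
Qed.

HB.instance Definition _ := GRing.Zmodule_isLmodule.Build A Q
  quot_scalerA quot_scale1r quot_scalerDr quot_scalerDl.

Lemma quotient_exists : exists (K : lmodType A) (p : {linear M -> K}),
  (forall k, exists x, p x = k) /\ forall x, p x = 0 <-> N x.
Proof.
have piL : linear pi.
  by move=> a x y; rewrite quot_pi_add -[pi (a *: x)]quot_pi_scale.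
exists Q, (mklinear piL); split=> /= [k | x]; first exact: quot_pi_surj.
by rewrite -[X in N X]subr0 -quot_pi_eq -[0](linear0 (mklinear piL)).
Qed.

End QuotientType.

Definition is_linear_rel (M N : lmodType A) (R : M -> N -> Prop) : Prop :=
  R 0 0 /\ forall (a : A) x x' y y', R x y -> R x' y' ->
    R (a *: x + x') (a *: y + y').

(** The linear maps below are unique solutions of linear equations; this lemma spares
    the verification of linearity in each case. *)
Lemma linear_of_rel (M N : lmodType A) (R : M -> N -> Prop) :
  is_linear_rel R -> (forall x, exists y, R x y) -> (forall y, R 0 y -> y = 0) ->
  exists f : {linear M -> N}, forall x, R x (f x).
Proof.
move=> [R0 RL] /choice [f Rf] R_inj.
have fL : linear f.
  move=> a x y; apply/eqP; rewrite -subr_eq0; apply/eqP/R_inj.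
  have := RL (-1) _ _ _ _ (RL a _ _ _ _ (Rf x) (Rf y)) (Rf (a *: x + y)).
  by rewrite !scaleN1r addNr [- _ + _]addrC.
by exists (mklinear fL).
Qed.

(** A linear relation is a submodule of the product; when its projection to a
    projective module is onto, the projection has a section. *)
Lemma projective_choice (P N : lmodType A) (R : P -> N -> Prop) :
  is_projective P -> is_linear_rel R -> (forall x, exists y, R x y) ->
  exists f : {linear P -> N}, forall x, R x (f x).
Proof.
move=> P_proj [R0 RL] R_tot.
have R_sub : is_submodule (fun z : P * N => R z.1 z.2).
  by split=> [|a x y]; [exact: R0 | exact: RL].
have [K [i [_ iP]]] := submodule_exists R_sub.
have [x | g Hg] := P_proj K P (fst \o i) idfun.
  have [y Rxy] := R_tot x.
  by have [k ik] := (iP (x, y)).1 Rxy; exists k; rewrite /= ik.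
exists (snd \o i \o g) => x; have /= gx := Hg x.
by rewrite -{1}gx; apply/(iP (i (g x))); exists (g x).
Qed.

End Submodules.

(** * Projective dimension *)

Section ProjectiveDimension.

Variable A : pzRingType.

Definition surjection (M N : lmodType A) (f : M -> N) : Prop :=
  forall y, exists x, f x = y.

Lemma projective_retract (M P : lmodType A) (s : {linear M -> P})
    (r : {linear P -> M}) :
  is_projective P -> (forall x, r (s x) = x) -> is_projective M.
Proof.
move=> P_proj rs X Y p f p_surj.
have [g pg] := P_proj X Y p (f \o r) p_surj.
by exists (g \o s) => x /=; rewrite pg /= rs.
Qed.

Lemma projective_prod (P Q : lmodType A) :
  is_projective P -> is_projective Q -> is_projective (P * Q)%type.
Proof.
move=> P_proj Q_proj X Y p f p_surj.
have inlL : linear (fun x : P => (x, 0) : P * Q).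
  by move=> a x y; apply: injective_projections; rewrite //= scaler0 addr0.
have inrL : linear (fun y : Q => (0, y) : P * Q).
  by move=> a x y; apply: injective_projections; rewrite //= scaler0 addr0.
have [g pg] := P_proj X Y p (f \o mklinear inlL) p_surj.
have [h ph] := Q_proj X Y p (f \o mklinear inrL) p_surj.
have ghL : linear (fun z : P * Q => g z.1 + h z.2).
  by move=> a x y; rewrite !linearP /= scalerDr addrACA.
exists (mklinear ghL) => -[x y] /=; rewrite linearD pg ph /= -linearD.
by congr (f _); apply: injective_projections; rewrite /= ?addr0 ?add0r.
Qed.

Definition trivial_module (M : lmodType A) : Prop := forall x : M, x = 0.

Lemma trivial_rV0 : trivial_module ('rV[A]_0 : lmodType A).
Proof. by move=> x; rewrite [x]thinmx0. Qed.

Lemma projective_trivial (P : lmodType A) : trivial_module P -> is_projective P.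
Proof.
move=> P0 X Y p f _.
by exists (\0 : {linear P -> X}) => x; rewrite (P0 x) !linear0.
Qed.

Definition short_exact (K P M : lmodType A) (i : K -> P) (p : P -> M) : Prop :=
  [/\ injective i, surjection p & forall x, p x = 0 <-> exists k, i k = x].

Lemma kernel_exists (P M : lmodType A) (p : {linear P -> M}) :
  surjection p -> exists (K : lmodType A) (i : {linear K -> P}), short_exact i p.
Proof.
move=> p_surj; have ker_sub : is_submodule (fun x => p x = 0).
  by split=> [|a x y px py]; rewrite ?linear0 // linearP px py scaler0 addr0.
by have [K [i [i_inj iP]]] := submodule_exists ker_sub; exists K, i.
Qed.

Definition isomorphic (M N : lmodType A) : Prop :=
  exists f : {linear M -> N}, injective f /\ surjection f.

Lemma linear_inverse (M N : lmodType A) (f : {linear M -> N}) :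
  injective f -> surjection f ->
  exists g : {linear N -> M}, cancel f g /\ cancel g f.
Proof.
move=> f_inj f_surj.
have [|y||g fg] := @linear_of_rel A N M (fun y x => f x = y).
- by split=> [|a x x' y y' <- <-]; rewrite (linear0, linearP).
- exact: f_surj.
- by move=> y /eqP; rewrite raddf_eq0 // => /eqP.
by exists g; split=> x; [apply: f_inj; rewrite fg | exact: fg].
Qed.

Lemma projective_iso (M N : lmodType A) :
  isomorphic M N -> is_projective M -> is_projective N.
Proof.
move=> [f [f_inj f_surj]] M_proj; have [g [fK gK]] := linear_inverse f_inj f_surj.
exact: projective_retract M_proj gK.
Qed.

Fixpoint pd_le (n : nat) (M : lmodType A) : Prop :=
  if n is m.+1 then
    exists (P K : lmodType A) (i : {linear K -> P}) (p : {linear P -> M}),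
      [/\ is_projective P, short_exact i p & pd_le m K]
  else is_projective M.

Lemma pd_le_iso n (M N : lmodType A) : isomorphic M N -> pd_le n M -> pd_le n N.
Proof.
case: n => [|n]; first exact: projective_iso.
move=> [f [f_inj f_surj]] [P [K [i [p [P_proj [i_inj p_surj ip] pdK]]]]].
exists P, K, i, (f \o p); split=> //; split=> [//| y | x /=].
  by have [z <-] := f_surj y; have [x <-] := p_surj z; exists x.
by rewrite -ip; split=> [/eqP | ->]; rewrite ?linear0 // raddf_eq0 // => /eqP.
Qed.

(** The resolution is cut at the kernel of its augmentation, through which the first
    differential factors. *)
Lemma pd_le_resolution n (M : lmodType A) :
  (exists2 m, (m <= n)%N & has_projective_resolution M m) -> pd_le n M.
Proof.
elim: n M => [|n IHn] M [m le_mn [P [d [e [P_proj P0 e_surj eP dP]]]]].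
  apply: (projective_iso _ (P_proj 0%N)); exists e; split=> //.
  apply: raddf_inj => x /eP [x' <-]; rewrite [x']P0 ?linear0 //.
have [K [i iP]] := kernel_exists e_surj; have [i_inj _ ei] := iP.
have [|x||e' ie'] := @linear_of_rel A (P 1%N) K (fun x k => i k = d 0%N x).
- by split=> [|a x x' y y' iy iy']; rewrite ?linear0 // !linearP iy iy'.
- by apply/ei/eP; exists x.
- by move=> y; rewrite linear0 => /eqP; rewrite raddf_eq0 // => /eqP.
exists (P 0%N), K, i, e; split=> //; apply: IHn; exists m.-1.
  by lia.
exists (fun j => P j.+1), (fun j => d j.+1), e'; split=> //.
- by move=> j lt_mj; apply: P0; lia.
- move=> k; have /eP [x dx] : e (i k) = 0 by apply/ei; exists k.
  by exists x; apply: i_inj; rewrite ie'.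
- move=> x; rewrite -dP -ie'; split=> [-> | /eqP]; first exact: linear0.
  by rewrite raddf_eq0 // => /eqP.
Qed.

Lemma pd_le_gldim n (M : lmodType A) : gldim A = Some n -> pd_le n M.
Proof.
rewrite /gldim /inf_nat; case: pselect => // ex [<-]; case: ex_minnP => m /asboolP.
move=> /(_ M) + _; rewrite /proj_dim /inf_nat; case: pselect => //= ex'.
case: ex_minnP => j /asboolP res _ le_jm; apply: pd_le_resolution.
by exists j.
Qed.

Lemma pd_le_prodr n (M P : lmodType A) :
  is_projective P -> pd_le n M -> pd_le n (M * P)%type.
Proof.
case: n => [|n] P_proj; first by move=> M_proj; exact: projective_prod.
move=> [P0 [K [i [p [P0_proj [i_inj p_surj ip] pdK]]]]].
have iL : linear (fun k : K => (i k, 0) : P0 * P).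
  by move=> a x y; apply: injective_projections; rewrite /= ?linearP ?scaler0 ?addr0.
have pL : linear (fun z : P0 * P => (p z.1, z.2) : M * P).
  by move=> a x y; apply: injective_projections; rewrite /= ?linearP.
exists (P0 * P)%type, K, (mklinear iL), (mklinear pL); split=> //.
  exact: projective_prod.
split=> [x y [] /i_inj // | [x y] | [x y] /=].
  by have [z <-] := p_surj x; exists (z, y).
split=> [[/ip [k <-] ->] | [k [<- <-]]]; first by exists k.
by congr (_, _); apply/ip; exists k.
Qed.

(** Schanuel's lemma: both products are the fibre product of the two
    presentations, which splits over either projective module. *)
Lemma schanuel (M P Q K L : lmodType A) (i : {linear K -> P}) (p : {linear P -> M})
    (j : {linear L -> Q}) (q : {linear Q -> M}) :
  is_projective P -> is_projective Q -> short_exact i p -> short_exact j q ->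
  isomorphic (L * P)%type (K * Q)%type.
Proof.
move=> P_proj Q_proj [i_inj p_surj ip] [j_inj q_surj jq].
have [a qa] := P_proj Q M q p q_surj; have [b pb] := Q_proj P M p q p_surj.
pose R (u : L * P) (v : K * Q) := v.2 = j u.1 + a u.2 /\ u.2 = i v.1 + b v.2.
have [||| f fR] := @linear_of_rel A (L * P)%type (K * Q)%type R.
- split=> [|c [x y] [x' y'] [z t] [z' t'] [/= zE yE] [/= z'E y'E]].
    by split; rewrite /= !linear0 addr0.
  split=> /=; rewrite !linearP.
    by rewrite {}zE {}z'E scalerDr addrACA.
  by rewrite {}yE {}y'E scalerDr addrACA.
- move=> [l x]; have : p (x - b (j l + a x)) = 0.
    rewrite linearB pb linearD qa (_ : q (j l) = 0) ?add0r ?subrr //.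
    by apply/jq; exists l.
  by move=> /ip [k ik]; exists (k, j l + a x); split; rewrite //= ik subrK.
- move=> [k y] [/= -> /eqP]; rewrite !linear0 addr0 linear0 addr0 eq_sym.
  by rewrite raddf_eq0 // => /eqP ->.
exists f; split=> [|[k y]].
  apply: raddf_inj => -[l x] f0; have [/=] := fR (l, x); rewrite f0 /= !linear0.
  move=> + x0; rewrite {}x0 addr0 linear0 addr0 => /esym/eqP.
  by rewrite raddf_eq0 // => /eqP ->.
have : q (y - a (i k + b y)) = 0.
  rewrite linearB qa linearD pb (_ : p (i k) = 0) ?add0r ?subrr //.
  by apply/ip; exists k.
move=> /jq [l jl]; exists (l, i k + b y); have [/=] := fR (l, i k + b y).
rewrite jl subrK; case: (f _) => k' y' /= -> /addIr /i_inj <-.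
by [].
Qed.

(** Schanuel's lemma compares syzygies only up to projective summands. Allowing for
    such a summand makes the bound pass to the kernel of any projective cover, not just
    of the one in a given resolution (see [stable_pd_syzygy]). *)
Definition stable_pd_le (n : nat) (M : lmodType A) : Prop :=
  exists2 Q : lmodType A, is_projective Q & pd_le n (M * Q)%type.

Lemma stable_pd_le_of n (M : lmodType A) : pd_le n M -> stable_pd_le n M.
Proof.
move=> pdM; have P0 := projective_trivial trivial_rV0.
by exists 'rV[A]_0; last exact: pd_le_prodr.
Qed.

Lemma stable_pd_le0 (M : lmodType A) : stable_pd_le 0 M -> is_projective M.
Proof.
move=> [Q Q_proj MQ_proj].
have sL : linear (fun x : M => (x, 0) : M * Q).
  by move=> a x y; apply: injective_projections; rewrite //= scaler0 addr0.
have rL : linear (fun z : M * Q => z.1) by [].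
exact: (@projective_retract _ _ (mklinear sL) (mklinear rL)).
Qed.

Lemma stable_pd_syzygy n (K P M : lmodType A) (i : {linear K -> P})
    (p : {linear P -> M}) :
  is_projective P -> short_exact i p ->
  stable_pd_le n.+1 M -> stable_pd_le n K.
Proof.
move=> P_proj [i_inj p_surj ip] [Q Q_proj [P0 [L [j [q [P0_proj jq pdL]]]]]].
have iL : linear (fun k : K => (i k, 0) : P * Q).
  by move=> a x y; apply: injective_projections; rewrite /= ?linearP ?scaler0 ?addr0.
have pL : linear (fun z : P * Q => (p z.1, z.2) : M * Q).
  by move=> a x y; apply: injective_projections; rewrite /= ?linearP.
have se : short_exact (mklinear iL) (mklinear pL).
  split=> [x y [] /i_inj // | [x y] | [x y] /=].
    by have [z <-] := p_surj x; exists (z, y).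
  split=> [[/ip [k <-] ->] | [k [<- <-]]]; first by exists k.
  by congr (_, _); apply/ip; exists k.
exists P0 => //.
have PQ_proj := projective_prod P_proj Q_proj.
by apply: pd_le_iso (schanuel PQ_proj P0_proj se jq) (pd_le_prodr _ pdL).
Qed.

End ProjectiveDimension.

(** * Free modules *)

Section FreeModules.

Variable A : pzRingType.

Definition is_free_on (S : Type) (F : lmodType A) (e : S -> F) : Prop :=
  (forall (M : lmodType A) (u : S -> M),
     exists w : {linear F -> M}, forall s, w (e s) = u s) /\
  (forall (M : lmodType A) (w w' : {linear F -> M}),
     (forall s, w (e s) = w' (e s)) -> w =1 w').

Lemma free_projective (S : Type) (F : lmodType A) (e : S -> F) :
  is_free_on e -> is_projective F.
Proof.
move=> [lift_e ext_e] M N p f p_surj.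
have [u pu] := choice (fun s => p_surj (f (e s))).
have [g gu] := lift_e M u; exists g.
by apply: (ext_e N (p \o g) f) => s /=; rewrite gu.
Qed.

Section FormalSums.

Variable S : choiceType.
Implicit Type l : seq (A * S).

Definition coefficient l (s : S) : A := \sum_(t <- l | t.2 == s) t.1.

Definition eval_sum (M : lmodType A) (u : S -> M) l : M :=
  \sum_(t <- l) t.1 *: u t.2.

(** The value of a formal sum depends only on its coefficients; this is what makes the
    universal property of the free module well defined. *)
Lemma eval_sum_coefficient (M : lmodType A) (u : S -> M) l (r : seq S) :
  uniq r -> {subset [seq t.2 | t <- l] <= r} ->
  eval_sum u l = \sum_(s <- r) coefficient l s *: u s.
Proof.
move=> r_uniq sub_r.
transitivity (\sum_(s <- r) \sum_(t <- l | t.2 == s) t.1 *: u s); last first.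
  by apply: eq_bigr => s _; rewrite -scaler_suml.
rewrite (exchange_big_dep xpredT) //=; apply: eq_big_seq => t lt.
rewrite -big_filter (_ : [seq s <- r | t.2 == s] = [:: t.2]) ?big_seq1 //.
have tr : t.2 \in r by apply: sub_r; exact: map_f.
by rewrite -(filter_pred1_uniq r_uniq tr); apply: eq_filter => s; exact: eq_sym.
Qed.

Lemma coefficient_lin (a : A) l l' :
  coefficient ([seq (a * t.1, t.2) | t <- l] ++ l') =
  a *: (coefficient l : S -> A^o) + (coefficient l' : S -> A^o).
Proof.
apply/funext => s; rewrite /coefficient big_cat big_map /=; congr (_ + _).
by rewrite -mulr_sumr.
Qed.

Lemma eval_sum_lin (M : lmodType A) (u : S -> M) (a : A) l l' :
  eval_sum u ([seq (a * t.1, t.2) | t <- l] ++ l') =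
  a *: eval_sum u l + eval_sum u l'.
Proof.
rewrite /eval_sum big_cat big_map scaler_sumr; congr (_ + _).
by apply: eq_bigr => t _; rewrite scalerA.
Qed.

Lemma eval_sum_coefficient0 (M : lmodType A) (u : S -> M) l :
  (coefficient l : S -> A^o) = 0 -> eval_sum u l = 0.
Proof.
move=> l0; rewrite (@eval_sum_coefficient M u l (undup [seq t.2 | t <- l])).
- by rewrite big1 // => s _; rewrite l0 /= scale0r.
- exact: undup_uniq.
- by move=> s; rewrite mem_undup.
Qed.

(** The free module is the module of functions of the form [coefficient l], that
    is, of functions on the basis with finite support. *)
Lemma free_module_exists : exists (F : lmodType A) (e : S -> F),
  is_free_on e /\ forall x : F, exists l, x = eval_sum e l.
Proof.
pose fin (f : S -> A^o) := exists l, f = coefficient l.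
have fin_sub : is_submodule fin.
  split=> [|a _ _ [l ->] [l' ->]].
    by exists [::]; apply/funext => s; rewrite /coefficient big_nil.
  by eexists; rewrite -coefficient_lin.
have [F [i [i_inj iP]]] := submodule_exists fin_sub.
have /choice [e ie] s : exists x, i x = coefficient [:: (1, s)].
  by apply/iP; exists [:: (1, s)].
have i_eval l : i (eval_sum e l) = coefficient l.
  rewrite /eval_sum linear_sum; apply/funext => s; rewrite fct_sumE.
  rewrite /coefficient [RHS]big_mkcond; apply: eq_bigr => t _.
  rewrite linearZ ie -[LHS]/(t.1 * coefficient [:: (1, t.2)] s) /coefficient.
  by rewrite big_mkcond big_seq1 /=; case: eqP => _; rewrite ?mulr1 ?mulr0.
have e_span x : exists l, x = eval_sum e l.
  have [|l il] := (iP (i x)).2 _; first by exists x.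
  by exists l; apply: i_inj; rewrite i_eval.
exists F, e; split=> //; split=> [M u | M w w' ww' x]; last first.
  have [l ->] := e_span x; rewrite /eval_sum !linear_sum.
  by apply: eq_bigr => t _; rewrite !linearZ /= ww'.
pose R (x : F) (y : M) := exists2 l, i x = coefficient l & y = eval_sum u l.
have [|x|y [l]|w wR] := @linear_of_rel A F M R.
- split=> [|a x x' y y' [l ix ->] [l' ix' ->]].
    exists [::]; rewrite ?linear0 /eval_sum ?big_nil //.
    by apply/funext => s; rewrite /coefficient big_nil.
  exists ([seq (a * t.1, t.2) | t <- l] ++ l'); last by rewrite eval_sum_lin.
  by rewrite linearP ix ix' coefficient_lin.
- by have [l ->] := e_span x; exists (eval_sum u l), l.
- by rewrite linear0 => l0 ->; apply: eval_sum_coefficient0.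
exists w => s; have [l] := wR (e s); rewrite ie => le ->.
apply/eqP; rewrite -subr_eq0; apply/eqP.
have <- : eval_sum u [:: (1, s)] = u s by rewrite /eval_sum big_seq1 scale1r.
rewrite addrC -scaleN1r -eval_sum_lin; apply: eval_sum_coefficient0.
by rewrite coefficient_lin le scaleN1r addNr.
Qed.

End FormalSums.

Lemma free_finitely_generated n (F : lmodType A) (e : 'I_n -> F) :
  (forall x, exists l, x = eval_sum e l) -> finitely_generated F.
Proof.
move=> e_span; exists n, e => x; have [l ->] := e_span x.
exists (coefficient l); apply: eval_sum_coefficient; first exact: index_enum_uniq.
by move=> s _; rewrite mem_index_enum.
Qed.

End FreeModules.

(** * Cohomology of complexes *)

Section Cohomology.

Variable A : pzRingType.
Implicit Types C X Y : complex A.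

Lemma int_succ (m : int) : exists n, m = n + 1.
Proof. by exists (m - 1); rewrite subrK. Qed.

(** Indexed by the degree of the boundary, so that it makes sense in every degree
    without transporting along n - 1 + 1 = n. *)
Inductive is_boundary C : forall m, C m -> Prop :=
  IsBoundary n (y : C n) : is_boundary (cd n y).

Lemma is_boundaryP C n (x : C (n + 1)) : is_boundary x <-> exists y, x = cd n y.
Proof.
split=> [|[y ->]]; last exact: IsBoundary.
suff gen m (z : C m) : is_boundary z ->
    forall E : m = n + 1, exists y, eq_rect m (fun j => C j : Type) z (n + 1) E = cd n y.
  by move=> /gen /(_ erefl).
case=> {m z x} m y E; have mn := addIr 1 E; subst m.
by rewrite (eq_irrelevance E erefl); exists y.
Qed.

Lemma boundary0 C m : is_boundary (0 : C m).
Proof.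
have [n ->] := int_succ m; apply/is_boundaryP; exists 0; exact/esym/linear0.
Qed.

Lemma boundary_lin C m (a : A) (x y : C m) :
  is_boundary x -> is_boundary y -> is_boundary (a *: x + y).
Proof.
have [n e] := int_succ m; subst m => /is_boundaryP [x' ->] /is_boundaryP [y' ->].
by apply/is_boundaryP; exists (a *: x' + y'); rewrite linearP.
Qed.

Lemma boundaryD C m (x y : C m) :
  is_boundary x -> is_boundary y -> is_boundary (x + y).
Proof. by move=> bx by_; rewrite -[x]scale1r; exact: boundary_lin. Qed.

Lemma boundaryN C m (x : C m) : is_boundary x -> is_boundary (- x).
Proof.
by move=> bx; rewrite -[- x]addr0 -scaleN1r; exact: boundary_lin bx (boundary0 _ _).
Qed.

Lemma boundaryB C m (x y : C m) :
  is_boundary x -> is_boundary y -> is_boundary (x - y).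
Proof. by move=> bx /boundaryN; exact: boundaryD. Qed.

Lemma boundary_cycle C m (x : C m) : is_boundary x -> cd m x = 0.
Proof. by case=> n y; exact: cdd. Qed.

Lemma boundary_map X Y (f : chain_map X Y) m (x : X m) :
  is_boundary x -> is_boundary (f m x).
Proof. by case=> n y; rewrite -cmap_d; exact: IsBoundary. Qed.

Lemma quasi_iso_inj X Y (f : chain_map X Y) : quasi_iso f ->
  forall m (x : X m), cd m x = 0 -> is_boundary (f m x) -> is_boundary x.
Proof.
move=> f_qi m; have [n e] := int_succ m; subst m => x dx /is_boundaryP fx.
exact/is_boundaryP/(f_qi n).1.
Qed.

Lemma quasi_iso_surj X Y (f : chain_map X Y) : quasi_iso f ->
  forall m (y : Y m), cd m y = 0 ->
    exists x : X m, cd m x = 0 /\ is_boundary (y - f m x).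
Proof.
move=> f_qi m; have [n e] := int_succ m; subst m => y dy.
have [x [dx [y' ->]]] := (f_qi n).2 y dy; exists x; split=> //.
by rewrite addrAC subrr add0r; exact: IsBoundary.
Qed.

(** [rep h z] reads: the cycle z represents the class h. *)
Record is_cohomology C m (H : lmodType A) (rep : H -> C m -> Prop) : Prop := {
  rep_linear : is_linear_rel rep;
  rep_cycle : forall h z, rep h z -> cd m z = 0;
  rep_of_cycle : forall z, cd m z = 0 -> exists h, rep h z;
  rep_of_class : forall h, exists z, rep h z;
  rep_boundary : forall h z, rep h z -> (h = 0 <-> is_boundary z)
}.

Lemma cohomology_exists C m :
  exists (Z H : lmodType A) (i : {linear Z -> C m}) (p : {linear Z -> H})
    (rep : H -> C m -> Prop),
    [/\ injective i, surjection p & is_cohomology rep].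
Proof.
have Z_sub : is_submodule (fun z : C m => cd m z = 0).
  by split=> [|a x y dx dy]; rewrite ?linear0 // linearP dx dy scaler0 addr0.
have [Z [i [i_inj iP]]] := submodule_exists Z_sub.
have B_sub : is_submodule (fun z : Z => is_boundary (i z)).
  split=> [|a x y bx by_]; rewrite ?linear0 ?linearP; first exact: boundary0.
  exact: boundary_lin.
have [H [p [p_surj pP]]] := quotient_exists B_sub.
exists Z, H, i, p, (fun h z => exists z', i z' = z /\ p z' = h); split=> //.
split.
- split=> [|a h h' z z' [x [<- <-]] [x' [<- <-]]].
    by exists 0; rewrite !linear0.
  by exists (a *: x + x'); rewrite !linearP.
- by move=> h z [z' [<- _]]; apply/iP; exists z'.
- by move=> z /iP [z' <-]; exists (p z'), z'.
- by move=> h; have [z <-] := p_surj h; exists (i z), z.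
- by move=> h z [z' [<- <-]]; exact: pP.
Qed.

Lemma is_cohomology_iso X Y (f : chain_map X Y) m (H : lmodType A)
    (rep : H -> Y m -> Prop) :
  (forall n, injective (f n) /\ surjection (f n)) -> is_cohomology rep ->
  is_cohomology (fun h x => rep h (f m x)).
Proof.
move=> f_bij [[rep0 repL] repZ repC repT repB]; have [f_inj f_surj] := f_bij m.
split.
- by split=> [|a h h' z z' hz hz']; rewrite (linear0, linearP) //; exact: repL.
- move=> h z /repZ; rewrite cmap_d => /eqP.
  by rewrite raddf_eq0 => [/eqP //|]; exact: (f_bij _).1.
- by move=> z dz; apply: repC; rewrite cmap_d dz linear0.
- by move=> h; have [y hy] := repT h; have [x xy] := f_surj y; exists x; rewrite xy.
- move=> h z /repB ->; split; last exact: boundary_map.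
  have [n e] := int_succ m; subst m => /is_boundaryP [y fz].
  have [x xy] := (f_bij n).2 y; apply/is_boundaryP; exists x.
  by apply: f_inj; rewrite fz -xy cmap_d.
Qed.

(** A cycle x whose image is the boundary of y is the first component of the cycle
    (x, -y) of the cone, and a cycle of Y is the cycle (0, y) of the cone. *)
Lemma quasi_iso_of_cone X Y (f : chain_map X Y) :
  (forall m (z : cone f m), cd m z = 0 -> is_boundary z) -> quasi_iso f.
Proof.
move=> acyclic n; split=> [x dx [y fxy] | y dy].
  have [n' e] := int_succ n; subst n.
  have /acyclic/is_boundaryP [[a b] [xa _]] :
      cd _ ((x, - y) : cone f (n' + 1)) = 0.
    by apply: injective_projections; rewrite /= ?dx ?oppr0 // fxy linearN subrr.
  by exists (- a); rewrite linearN.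
have /acyclic/is_boundaryP [[a b] [da yab]] : cd _ ((0, y) : cone f (n + 1)) = 0.
  by apply: injective_projections; rewrite /= ?linear0 ?oppr0 ?add0r.
by exists a; split; [rewrite -[LHS]opprK -da oppr0 | exists b].
Qed.

End Cohomology.

(** * Homotopies *)

Section AdditiveIdentities.

Variable V : zmodType.
Implicit Types a b s t w x y : V.

Lemma addr_cancel_mid a b s : s + a + (b - s) = a + b.
Proof. by rewrite [s + a]addrC addrACA subrr addr0. Qed.

Lemma addr_shuffle_homotopy s t w x y :
  s - t - w + (x + y) = - w + (s + x + (y - t)).
Proof.
rewrite [s - t - w]addrC -!addrA; congr (_ + (_ + _)).
by rewrite addrCA; congr (_ + _); rewrite addrC.
Qed.

Lemma subr_shuffle a a' b b' : a' - b' = (a - b) - (a - a') + (b - b').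
Proof. by rewrite opprB [a - b + _]addrC !subrKA. Qed.

End AdditiveIdentities.

Section Homotopy.

Variable A : pzRingType.
Implicit Types X Y : complex A.

Definition homotopic X Y (f g : chain_map X Y) : Prop :=
  exists h : forall n, {linear X (n + 1) -> Y n}, forall n x,
    f (n + 1) x - g (n + 1) x = cd n (h n x) + h (n + 1) (cd (n + 1) x).

Section Cylinder.

Variable X : complex A.

(** The cone of the antidiagonal map from X to its square. Its maps to Y are the pairs
    of maps from X to Y together with a homotopy between them. *)
Definition cylinder_ob (n : int) : lmodType A := (X (n + 1)%R * (X n * X n))%type.

Definition cylinder_d n (p : cylinder_ob n) : cylinder_ob (n + 1) :=
  (- cd (n + 1) p.1, (p.1 + cd n p.2.1, cd n p.2.2 - p.1)).

Lemma cylinder_d_linear n : linear (@cylinder_d n).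
Proof.
move=> a [s [x y]] [s' [x' y']]; rewrite /cylinder_d /= !linearP /=.
congr (_, (_, _)); rewrite /= ?opprD ?scalerDr ?scalerN // addrACA //.
Qed.

Lemma cylinder_dd n (p : cylinder_ob n) :
  mklinear (@cylinder_d_linear (n + 1)) (mklinear (@cylinder_d_linear n) p) = 0.
Proof.
case: p => s [x y]; rewrite /= /cylinder_d /= !(linearD, linearN) !cdd /=.
by rewrite !addr0 sub0r !opprK !addNr.
Qed.

Definition cylinder : complex A :=
  @Complex A cylinder_ob (fun n => mklinear (@cylinder_d_linear n)) cylinder_dd.

Lemma cylinder_in0_linear n : linear (fun x : X n => (0, (x, 0)) : cylinder n).
Proof. by move=> a x y; congr (_, (_, _)); rewrite /= scaler0 addr0. Qed.

Lemma cylinder_in0_d n (x : X n) :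
  @cd _ cylinder n (mklinear (@cylinder_in0_linear n) x) =
  mklinear (@cylinder_in0_linear (n + 1)) (cd n x).
Proof. by rewrite /= /cylinder_d /= !linear0 ?add0r ?addr0. Qed.

Definition cylinder_in0 : chain_map X cylinder :=
  @ChainMap A X cylinder (fun n => mklinear (@cylinder_in0_linear n)) cylinder_in0_d.

Lemma cylinder_in1_linear n : linear (fun x : X n => (0, (0, x)) : cylinder n).
Proof. by move=> a x y; congr (_, (_, _)); rewrite /= scaler0 addr0. Qed.

Lemma cylinder_in1_d n (x : X n) :
  @cd _ cylinder n (mklinear (@cylinder_in1_linear n) x) =
  mklinear (@cylinder_in1_linear (n + 1)) (cd n x).
Proof. by rewrite /= /cylinder_d /= !linear0 ?add0r ?addr0. Qed.

Definition cylinder_in1 : chain_map X cylinder :=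
  @ChainMap A X cylinder (fun n => mklinear (@cylinder_in1_linear n)) cylinder_in1_d.

Lemma cylinder_proj_linear n : linear (fun p : cylinder n => p.2.1 + p.2.2 : X n).
Proof. by move=> a x y; rewrite /= scalerDr addrACA. Qed.

Lemma cylinder_proj_d n (p : cylinder n) :
  cd n (mklinear (@cylinder_proj_linear n) p) =
  mklinear (@cylinder_proj_linear (n + 1)) (@cd _ cylinder n p).
Proof. by rewrite /= linearD; exact/esym/addr_cancel_mid. Qed.

Definition cylinder_proj : chain_map cylinder X :=
  @ChainMap A cylinder X (fun n => mklinear (@cylinder_proj_linear n))
    cylinder_proj_d.

Lemma cylinder_proj_quasi_iso : quasi_iso cylinder_proj.
Proof.
move=> n; split=> [[s [x y]] /= | x dx].
  rewrite /cylinder_d /= => -[_ _ /eqP]; rewrite subr_eq0 => /eqP dy [z xyz].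
  exists (- y, (z, 0)) => /=; rewrite /cylinder_d /= linear0 linearN dy !opprK.
  by rewrite add0r -xyz [x + y]addrC addKr.
exists (cylinder_in0 (n + 1) x); split.
  by rewrite cmap_d dx linear0.
by exists 0; rewrite /= addr0 linear0 addr0.
Qed.

Section CylinderMap.

Variables (Y : complex A) (f g : chain_map X Y).
Variable h : forall n, {linear X (n + 1) -> Y n}.
Hypothesis hfg : forall n x,
  f (n + 1) x - g (n + 1) x = cd n (h n x) + h (n + 1) (cd (n + 1) x).

Lemma cylinder_map_linear n :
  linear (fun p : cylinder n => h n p.1 + (f n p.2.1 + g n p.2.2) : Y n).
Proof.
move=> a x y /=; rewrite !linearP !scalerDr [RHS]addrACA; congr (_ + _).
exact: addrACA.
Qed.

Lemma cylinder_map_d n (p : cylinder n) :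
  cd n (mklinear (@cylinder_map_linear n) p) =
  mklinear (@cylinder_map_linear (n + 1)) (@cd _ cylinder n p).
Proof.
case: p => s [x y]; rewrite /= !(linearD, linearN) /= -!cmap_d.
have -> : cd n (h n s) = f (n + 1) s - g (n + 1) s - h (n + 1) (cd (n + 1) s).
  by rewrite hfg addrK.
exact: addr_shuffle_homotopy.
Qed.

Definition cylinder_map : chain_map cylinder Y :=
  @ChainMap A cylinder Y (fun n => mklinear (@cylinder_map_linear n)) cylinder_map_d.

End CylinderMap.

End Cylinder.

(** Graded projective modules, seen as complexes with zero differential. *)
Definition graded_projective X : Prop :=
  (forall n, is_projective (X n)) /\ (forall n (x : X n), cd n x = 0).

(** Projectivity turns a degreewise choice of bounding elements into a homotopy. *)
Lemma graded_homotopic X Y (f g : chain_map X Y) :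
  graded_projective X -> (forall m x, is_boundary (f m x - g m x)) ->
  homotopic f g.
Proof.
move=> [X_proj dX] fg.
have hP n : exists h : {linear X (n + 1) -> Y n},
    forall x, f (n + 1) x - g (n + 1) x = cd n (h x).
  have [||h hR] := @projective_choice A _ (Y n)
    (fun x y => f (n + 1) x - g (n + 1) x = cd n y) (X_proj (n + 1)).
  - split=> [|a x x' y y' xy xy']; first by rewrite !linear0 addr0.
    by rewrite !linearP -xy -xy' scalerDr addrACA.
  - by move=> x; exact/is_boundaryP.
  by exists h.
pose h n := projT1 (cid (hP n)); exists h => n x.
by rewrite dX linear0 addr0; exact: (projT2 (cid (hP n))).
Qed.

Lemma graded_lift X Y Z (q : chain_map Y Z) (f : chain_map X Z) :
  graded_projective X -> quasi_iso q ->
  exists g : chain_map X Y, homotopic (comp_map g q) f.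
Proof.
move=> X_gp q_qi; have [X_proj dX] := X_gp.
have gP m : exists g : {linear X m -> Y m},
    forall x, cd m (g x) = 0 /\ is_boundary (f m x - q m (g x)).
  have [||g gR] := @projective_choice A _ (Y m)
    (fun x y => cd m y = 0 /\ is_boundary (f m x - q m y)) (X_proj m).
  - split=> [|a x x' y y' [dy xy] [dy' xy']].
      by rewrite !linear0 addr0; split=> //; exact: boundary0.
    rewrite !linearP dy dy' scaler0 addr0; split=> //.
    by rewrite addrACA -scalerDr; exact: boundary_lin.
  - by move=> x; apply: (quasi_iso_surj q_qi); rewrite cmap_d dX linear0.
  by exists g.
pose g m := projT1 (cid (gP m)).
have g_d n x : cd n (g n x) = g (n + 1) (cd n x).
  by rewrite dX linear0; exact: (projT2 (cid (gP n)) x).1.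
exists (ChainMap g_d); apply: graded_homotopic => // m x /=.
by rewrite -opprB; apply: boundaryN; exact: (projT2 (cid (gP m)) x).2.
Qed.

End Homotopy.

(** * Morphisms in the derived category out of graded projective modules *)

Section DerivedHom.

Variables (A : pzRingType) (P : module_class A).
Implicit Types X Y Z : bounded_complexes P.

Local Notation qi := (@bquasi_iso A P).
Local Notation "p ~= q" := (zigzag_eq p q) (at level 70).

Lemma cylinder_bounded X : is_bounded (cylinder X).
Proof.
have [N XN] := bc_bounded X; exists N.+1 => n Nn [s [x y]].
by congr (_, (_, _)); apply: XN; lia.
Qed.

Definition bcylinder X : bounded_complex P :=
  @BoundedComplex A P (cylinder X) (cylinder_bounded X)
    (fun n => in_classD (bc_class X (n + 1)) (in_classD (bc_class X n) (bc_class X n))).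

Lemma quot_map_comp X Y Z (f : chain_map X Y) (g : chain_map Y Z) :
  quot_map (comp_map f g) ~= zcomp (quot_map f) (quot_map g).
Proof. exact: zeq_trans (zeq_fwd_comp _ _ _) (zeq_refl _). Qed.

Lemma quot_map_eq X Y (f g : chain_map X Y) :
  (forall n x, f n x = g n x) -> quot_map f ~= quot_map g.
Proof. by move=> fg; apply: zeq_fwd => n x; exact: fg. Qed.

Lemma quot_map_split_epi X Y (q : chain_map Y X) (f g : chain_map X Y) :
  quasi_iso q -> (forall n x, q n (f n x) = x) -> (forall n x, q n (g n x) = x) ->
  quot_map f ~= quot_map g.
Proof.
move=> q_qi qf qg; pose Wq := q_qi : qi (q : @hom (bounded_complexes P) Y X).
suff inv (f' : chain_map X Y) : (forall n x, q n (f' n x) = x) ->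
    quot_map f' ~= zinv Wq.
  by apply: zeq_trans (inv f qf) (zeq_sym (inv g qg)).
move=> qf'; apply: zeq_trans (zeq_sym (zeq_idr _)) _.
apply: zeq_trans (zeq_comp (zeq_refl _) (zeq_sym (zeq_invr Wq))) _.
apply: zeq_trans (zeq_compA _ _ _) _; apply: zeq_trans (zeq_idl _).
apply: zeq_comp (zeq_refl _); apply: zeq_trans (zeq_sym (zeq_fwd_comp _ _ _)) _.
by apply: zeq_fwd => n x; exact: qf'.
Qed.

(** Both ends of the cylinder are sections of its projection, which is invertible in
    the derived category. *)
Lemma quot_map_homotopic X Y (f g : chain_map X Y) :
  homotopic f g -> quot_map f ~= quot_map g.
Proof.
move=> [h hfg]; pose H := cylinder_map hfg.
pose i0 : chain_map X (bcylinder X) := cylinder_in0 X.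
pose i1 : chain_map X (bcylinder X) := cylinder_in1 X.
have ends : quot_map i0 ~= quot_map i1.
  apply: (@quot_map_split_epi _ (bcylinder X) (cylinder_proj X)) => [|n x|n x].
  - exact: cylinder_proj_quasi_iso.
  - by rewrite /= addr0.
  - by rewrite /= add0r.
pose H' : chain_map (bcylinder X) Y := H.
apply: (@zeq_trans _ _ _ _ _ (zcomp (quot_map i0) (quot_map H'))).
  apply: zeq_trans (quot_map_comp _ _); apply: quot_map_eq => n x.
  by rewrite /= !linear0 add0r addr0.
apply: zeq_trans (zeq_comp ends (zeq_refl _)) _.
apply: zeq_trans (zeq_sym (quot_map_comp _ _)) _; apply: quot_map_eq => n x.
by rewrite /= !linear0 !add0r.
Qed.

(** The relation that a zigzag induces on cycles: up to boundaries, the graph of the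
    induced map in cohomology. *)
Fixpoint zigzag_rel X Y (p : zigzag qi X Y) (m : int) : X m -> Y m -> Prop :=
  match p in zigzag _ X Y return bc X m -> bc Y m -> Prop with
  | zfwd X Y f => fun x y => [/\ cd m x = 0, cd m y = 0 &
      is_boundary (y - (f : chain_map X Y) m x)]
  | zinv X Y f _ => fun y x => [/\ cd m x = 0, cd m y = 0 &
      is_boundary (y - (f : chain_map X Y) m x)]
  | zcomp X Y Z p q => fun x z => exists y, zigzag_rel p x y /\ zigzag_rel q y z
  end.

Lemma zigzag_rel_boundary X Y (p : zigzag qi X Y) m (x x' : X m) (y y' : Y m) :
  is_boundary (x - x') -> is_boundary (y - y') ->
  zigzag_rel p x y -> zigzag_rel p x' y'.
Proof.
have cyc Z (z z' : Z m) : is_boundary (z - z') -> cd m z = 0 -> cd m z' = 0.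
  by move=> /boundary_cycle/eqP; rewrite linearB subr_eq0 => /eqP ->.
have step X' Y' (f : chain_map X' Y') (x1 x2 : X' m) (y1 y2 : Y' m) :
    is_boundary (x1 - x2) -> is_boundary (y1 - y2) ->
    is_boundary (y1 - f m x1) -> is_boundary (y2 - f m x2).
  move=> bx by_ b1; rewrite (_ : y2 - _ = (y1 - f m x1) - (y1 - y2) + f m (x1 - x2)).
    by apply: boundaryD (boundaryB _ _) (boundary_map _ _).
  by rewrite [f m (_ - _)]linearB; exact: subr_shuffle.
elim: p x x' y y' => {X Y} /=.
- by move=> X Y f x x' y y' bx by_ [dx dy b]; split; [exact: cyc dx|exact: cyc dy|exact: step b].
- by move=> X Y f _ y y' x x' by_ bx [dx dy b]; split; [exact: cyc dx|exact: cyc dy|exact: step b].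
move=> X Y Z p IHp q IHq x x' z z' bx bz [y [pxy qyz]]; exists y.
by split; [apply: IHp bx _ pxy | apply: IHq _ bz qyz]; rewrite subrr; exact: boundary0.
Qed.

Lemma zigzag_rel_cycle X Y (p : zigzag qi X Y) m (x : X m) (y : Y m) :
  zigzag_rel p x y -> cd m x = 0 /\ cd m y = 0.
Proof.
elim: p x y => {X Y} /= [X Y f x y [] // | X Y f _ y x [] // |].
by move=> X Y Z p IHp q IHq x z [y [/IHp [? _] /IHq [_ ?]]].
Qed.

(** The clauses for formal inverses hold because a quasi-isomorphism is one-to-one and
    onto on cycles modulo boundaries. *)
Lemma zigzag_rel_eq X Y (p q : zigzag qi X Y) : p ~= q ->
  forall m (x : X m) (y : Y m), zigzag_rel p x y <-> zigzag_rel q x y.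
Proof.
have refl0 Z m (z : bc Z m) : is_boundary (z - z) by rewrite subrr; exact: boundary0.
have symb Z m (z z' : bc Z m) : is_boundary (z - z') -> is_boundary (z' - z).
  by rewrite -opprB => /boundaryN; rewrite opprK.
have trb Z m (z z' z'' : bc Z m) : is_boundary (z - z') -> is_boundary (z' - z'') ->
    is_boundary (z - z'').
  by move=> /boundaryD h /h; rewrite addrA subrK.
elim=> {X Y p q} /=.
- by [].
- by move=> X Y p q _ IH m x y; rewrite IH.
- by move=> X Y p q r _ IH _ IH' m x y; rewrite IH.
- move=> X Y Z p p' q q' _ IH _ IH' m x z.
  by split=> -[y [/IH ? /IH' ?]]; exists y.
- move=> X Y Z U p q r m x u; split.
    by move=> [y [? [z [? ?]]]]; exists z; split=> //; exists y.
  by move=> [z [[y [? ?]] ?]]; exists y; split=> //; exists z.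
- move=> X Y p m x y; split=> [[x' [[_ _ b] pxy]] | pxy].
    exact: zigzag_rel_boundary b (refl0 _ _ _) pxy.
  by have [dx _] := zigzag_rel_cycle pxy; exists x; split.
- move=> X Y p m x y; split=> [[y' [pxy [_ _ b]]] | pxy].
    exact: zigzag_rel_boundary (refl0 _ _ _) (symb _ _ _ _ b) pxy.
  by have [_ dy] := zigzag_rel_cycle pxy; exists y; split.
- by move=> X Y f g fg m x y; rewrite (fg m x).
- move=> X Y Z f g m x z; split=> [[dx dz b] | [y [[dx dy b] [_ dz b']]]].
    exists ((f : chain_map X Y) m x); split; split=> //; rewrite cmap_d dx linear0 //.
  split=> //; apply: trb b' _; rewrite -linearB; exact: boundary_map.
- move=> X Y f Wf m x x'; split=> [[y [[dx dy b] [dx' _ b']]] | [dx dx' b]].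
    split=> //; apply: (quasi_iso_inj Wf); first by rewrite linearB dx dx' subrr.
    by rewrite linearB; apply: trb (symb _ _ _ _ b') b.
  have dfx : cd m ((f : chain_map X Y) m x) = 0 by rewrite cmap_d dx linear0.
  exists ((f : chain_map X Y) m x); split; split=> //.
  by rewrite -linearB; apply: boundary_map; exact: symb.
- move=> X Y f Wf m y y'; split=> [[x [[dx dy b] [_ dy' b']]] | [dy dy' b]].
    by split=> //; apply: trb b' (symb _ _ _ _ b).
  have [x [dx bx]] := quasi_iso_surj Wf dy; exists x; split; split=> //.
  exact: trb b bx.
Qed.

Lemma quot_map_inj_cohomology X Y (f g : chain_map X Y) :
  quot_map f ~= quot_map g ->
  forall m (x : X m), cd m x = 0 -> is_boundary (f m x - g m x).
Proof.
move=> fg m x dx; have [+ _] := zigzag_rel_eq fg x (f m x).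
case=> [|//]; split=> //; last by rewrite subrr; exact: boundary0.
by rewrite cmap_d dx linear0.
Qed.

(** Chain maps out of a graded projective module lift through quasi-isomorphisms, so
    that formal inverses can be removed one after the other. *)
Lemma graded_zigzag X Y (p : zigzag qi X Y) :
  graded_projective X -> exists f : chain_map X Y, p ~= quot_map f.
Proof.
move=> X_gp; suff gen Y0 Z (q : zigzag qi Y0 Z) (f : chain_map X Y0) :
    exists g : chain_map X Z, zcomp (quot_map f) q ~= quot_map g.
  have [g Hg] := gen X Y p (id_map X); exists g; apply: zeq_trans Hg.
  by apply: zeq_sym; exact: zeq_idl.
elim: q f => {Y p Y0 Z}.
- move=> Y Z g f; exists (comp_map f (g : chain_map Y Z)).
  by apply: zeq_sym; exact: quot_map_comp.
- move=> Y Z q Wq f; have [g gq] := graded_lift f X_gp Wq; exists g.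
  have eq1 : zcomp (quot_map g) (zfwd qi q) ~= quot_map f.
    apply: zeq_trans (zeq_sym (quot_map_comp g (q : chain_map Y Z))) _.
    exact: quot_map_homotopic.
  apply: zeq_trans (zeq_comp (zeq_sym eq1) (zeq_refl _)) _.
  apply: zeq_trans (zeq_sym (zeq_compA _ _ _)) _.
  apply: zeq_trans (zeq_comp (zeq_refl _) (zeq_invr Wq)) _; exact: zeq_idr.
- move=> Y Z U q IHq r IHr f; have [g Hg] := IHq f; have [h Hh] := IHr g.
  exists h; apply: zeq_trans (zeq_compA _ _ _) _.
  exact: zeq_trans (zeq_comp Hg (zeq_refl _)) Hh.
Qed.

Definition linear_coproduct (S : Type) (F : S -> lmodType A) (Z : lmodType A)
    (i : forall s, {linear F s -> Z}) : Prop :=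
  (forall (M : lmodType A) (u : forall s, {linear F s -> M}),
     exists w : {linear Z -> M}, forall s x, w (i s x) = u s x) /\
  (forall (M : lmodType A) (w w' : {linear Z -> M}),
     (forall s x, w (i s x) = w' (i s x)) -> w =1 w').

(** Morphisms out of a graded projective module are chain maps modulo homotopy, and
    both chain maps and homotopies can be glued along a degreewise coproduct. *)
Lemma graded_coproduct (S : Type) (F : S -> bounded_complexes P)
    (Z : bounded_complexes P) (i : forall s, chain_map (F s) Z) :
  (forall s, graded_projective (F s)) -> graded_projective Z ->
  (forall n, @linear_coproduct S (fun s => F s n) (Z n) (fun s => i s n)) ->
  @is_coproduct (Db_cat P) S F Z (fun s => quot_map (i s)).
Proof.
move=> F_gp Z_gp i_cop U g; have dZ := Z_gp.2.
pose f s := projT1 (cid (graded_zigzag (g s) (F_gp s))).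
have fE s : g s ~= quot_map (f s) := projT2 (cid (graded_zigzag (g s) (F_gp s))).
have hP n : exists h : {linear Z n -> U n}, forall s x, h (i s n x) = f s n x.
  by have [h hE] := (i_cop n).1 (U n) (fun s => f s n); exists h.
pose h n := projT1 (cid (hP n)).
have hE n s x : h n (i s n x) = f s n x := projT2 (cid (hP n)) s x.
have h_d n x : cd n (h n x) = h (n + 1) (cd n x).
  rewrite dZ linear0.
  apply: ((i_cop n).2 _ (cd n \o h n) (\0 : {linear Z n -> U (n + 1)})) => s y /=.
  by rewrite hE cmap_d (F_gp s).2 linear0.
exists (quot_map (ChainMap h_d)); split=> [s | h' h'P].
  apply: zeq_trans (zeq_sym (fE s)); apply: zeq_trans (zeq_sym (quot_map_comp _ _)) _.
  by apply: quot_map_eq => n x; exact: hE.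
have [k kE] := graded_zigzag h' Z_gp; apply: (zeq_trans kE _).
apply: quot_map_homotopic.
have tP n : exists t : {linear Z (n + 1) -> U n},
    forall x, k (n + 1) x - h (n + 1) x = cd n (t x).
  have tsP s : exists t : {linear F s (n + 1) -> U n}, forall x,
      k (n + 1) (i s (n + 1) x) - h (n + 1) (i s (n + 1) x) = cd n (t x).
    have [|||t tE] := @projective_choice A (F s (n + 1)) (U n) (fun x y =>
      k (n + 1) (i s (n + 1) x) - h (n + 1) (i s (n + 1) x) = cd n y).
    - exact: (F_gp s).1.
    - split=> [|a x x' y y' xy xy']; first by rewrite !linear0 addr0.
      by rewrite !linearP -xy -xy' scalerDr addrACA.
    - move=> x; apply/is_boundaryP; rewrite hE.
      apply: (@quot_map_inj_cohomology _ _ (comp_map (i s) k) (f s)).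
        apply: zeq_trans (fE s); apply: zeq_trans (h'P s).
        apply: zeq_trans (quot_map_comp _ _) _.
        by apply: zeq_comp (zeq_refl _) (zeq_sym kE).
      exact: (F_gp s).2.
    by exists t.
  pose ts s := projT1 (cid (tsP s)).
  have [t tE] := (i_cop (n + 1)).1 _ ts; exists t => x.
  have khL : linear (fun x => k (n + 1) x - h (n + 1) x).
    by move=> a y z; rewrite !linearP scalerDr addrACA.
  apply: ((i_cop (n + 1)).2 _ (mklinear khL) (cd n \o t)) => s y /=.
  by rewrite tE; exact: (projT2 (cid (tsP s)) y).
pose t n := projT1 (cid (tP n)); exists t => n x.
by rewrite dZ linear0 addr0; exact: (projT2 (cid (tP n)) x).
Qed.

End DerivedHom.

(** * Generation in the derived category *)

Section Isomorphisms.

Variable T : triangulated_data.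
Implicit Types (I : T -> Prop) (X Y : T).

Lemma span_iso I X Y (f : hom X Y) : is_iso f -> span I X -> span I Y.
Proof.
move=> [g [fg gf]] IX; apply: (@span_sum T I 1 (fun _ => X)) => //.
exists (fun _ => f) => U u; exists (comp g (u ord0)); split=> [s | h hP].
  rewrite [s]ord1; apply: heq_trans (compA _ _ _) _.
  exact: heq_trans (comp_heq fg (heq_refl _)) (comp_idl _).
apply: heq_trans (comp_heq (heq_refl g) (hP ord0)).
apply: heq_trans (heq_sym (comp_idl h)) _.
apply: heq_trans (comp_heq (heq_sym gf) (heq_refl h)) _.
exact: heq_sym (compA _ _ _).
Qed.

Lemma is_zero_iso X Y (f : hom X Y) : is_iso f -> is_zero X -> is_zero Y.
Proof.
move=> [g [fg gf]] X0 Z; have [[a aP] [b bP]] := X0 Z; split.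
  exists (comp g a) => h; apply: heq_trans (comp_heq (heq_refl g) (aP (comp f h))).
  apply: heq_trans (heq_sym (compA _ _ _)).
  apply: heq_trans (heq_sym (comp_idl h)) (comp_heq (heq_sym gf) (heq_refl h)).
exists (comp b f) => h; apply: heq_trans (comp_heq (bP (comp h g)) (heq_refl f)).
apply: heq_trans (compA _ _ _).
apply: heq_trans (heq_sym (comp_idr h)) (comp_heq (heq_refl h) (heq_sym gf)).
Qed.

Lemma span_iter_iso I j X Y (f : hom X Y) :
  is_iso f -> span_iter I j X -> span_iter I j Y.
Proof. by case: j => [|j]; [exact: is_zero_iso | exact: span_iso]. Qed.

End Isomorphisms.

Section DerivedGeneration.

Variables (A : pzRingType) (P : module_class A).
Implicit Types X Y Q : bounded_complex P.

Lemma quasi_iso_is_iso X Y (f : chain_map X Y) :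
  quasi_iso f -> @is_iso (Db_cat P) X Y (quot_map f).
Proof.
move=> f_qi; pose Wf := f_qi : bquasi_iso (f : @hom (bounded_complexes P) X Y).
by exists (zinv Wf); split; [exact: (zeq_invr Wf) | exact: (zeq_invl Wf)].
Qed.

Lemma bijective_quasi_iso X Y (f : chain_map X Y) :
  (forall n, injective (f n) /\ surjection (f n)) -> quasi_iso f.
Proof.
move=> f_bij n; split=> [x dx [y fx] | y dy].
  have [z zy] := (f_bij n).2 y; exists z; apply: (f_bij (n + 1)).1.
  by rewrite -cmap_d zy.
have [x xy] := (f_bij (n + 1)).2 y; exists x; split.
  by apply: (f_bij (n + 1 + 1)).1; rewrite -cmap_d xy dy linear0.
by exists 0; rewrite linear0 addr0.
Qed.

(** Initiality follows from [graded_zigzag], as the zero module is projective. For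
    terminality, composing any zigzag with the zero map to X gives the zero map. *)
Lemma trivial_is_zero X : (forall n, trivial_module (X n)) -> @is_zero (Db P) X.
Proof.
move=> X0 Y; split.
  have X_gp : graded_projective X.
    by split=> n; [exact: projective_trivial | move=> x; rewrite [x]X0 linear0].
  have zero_d n (x : X n) : cd n ((\0 : X n -> Y n) x) = (\0 : X (n + 1) -> Y (n + 1)) (cd n x).
    exact: linear0.
  pose z := @ChainMap A X Y (fun n => \0) zero_d.
  exists (quot_map z) => f; have [g fg] := graded_zigzag f X_gp.
  by apply: zeq_trans fg _; apply: quot_map_eq => n x; rewrite [x]X0 !linear0.
have zero_d (Z : bounded_complex P) n (z : Z n) :
    cd n ((\0 : Z n -> X n) z) = (\0 : Z (n + 1) -> X (n + 1)) (cd n z).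
  exact: linear0.
pose zero (Z : bounded_complex P) := @ChainMap A Z X (fun n => \0) (zero_d Z).
have zeroP Z Z' (p : zigzag (@bquasi_iso A P) Z Z') :
    zigzag_eq (zcomp p (quot_map (zero Z'))) (quot_map (zero Z)).
  elim: p => {Z Z'}.
  - move=> Z Z' f; apply: zeq_trans (zeq_sym (quot_map_comp (f : chain_map _ _) _)) _.
    exact: quot_map_eq.
  - move=> Z Z' f Wf.
    have fz : zigzag_eq (quot_map (zero Z)) (zcomp (zfwd _ f) (quot_map (zero Z'))).
      apply: zeq_trans (quot_map_comp (f : chain_map _ _) _); exact: quot_map_eq.
    apply: zeq_trans (zeq_comp (zeq_refl _) fz) _; apply: zeq_trans (zeq_compA _ _ _) _.
    exact: zeq_trans (zeq_comp (zeq_invl Wf) (zeq_refl _)) (zeq_idl _).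
  - move=> Z Z' Z'' p IHp q IHq; apply: zeq_trans (zeq_sym (zeq_compA _ _ _)) _.
    exact: zeq_trans (zeq_comp (zeq_refl _) IHq) IHp.
exists (quot_map (zero Y)) => p; apply: zeq_trans (zeroP _ _ p).
apply: zeq_trans (zeq_sym (zeq_idr p)) _; apply: zeq_comp (zeq_refl _) _.
by apply: quot_map_eq => n x; rewrite [LHS]X0 [RHS]X0.
Qed.

(** The triangle X -> Y -> cone f -> X[1] is distinguished by definition. *)
Lemma span_iter_cone (I : Db P -> Prop) j X Y (f : chain_map X Y) :
  span_iter I j X -> span I (bcone f : Db P) -> span_iter I j.+1 Y.
Proof.
move=> IX If; apply: span_in.
exists X, (bcone f), (quot_map f), (@quot_map _ _ Y (bcone f) (cone_in f)),
  (@quot_map _ _ (bcone f) (bshift X) (cone_out f)).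
split=> //; exists X, Y, f, (idm _), (idm _), (idm _).
have iso_id (Z : Db_cat P) : is_iso (idm Z).
  by exists (idm Z); split; exact: zeq_idl.
split=> //.
- exact: zeq_trans (zeq_idr _) (zeq_sym (zeq_idl _)).
- exact: zeq_trans (zeq_idr _) (zeq_sym (zeq_idl _)).
apply: zeq_trans (zeq_sym (zeq_idl _)).
apply: zeq_trans (zeq_comp (zeq_refl _) (zigzag_shift_id _)) _.
exact: zeq_idr.
Qed.

Section GradedGeneration.

Variable I : Db P -> Prop.
Hypothesis stalk_span : forall (M : lmodType A) (PM : P M),
  is_projective M -> span I (bstalk PM : Db P).

Lemma graded_iso_span X Y :
  graded_projective X -> graded_projective Y ->
  (forall n, isomorphic (X n) (Y n)) -> span I (X : Db P) -> span I (Y : Db P).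
Proof.
move=> [_ dX] [_ dY] XY; pose f n := projT1 (cid (XY n)).
have fP n : injective (f n) /\ surjection (f n) := projT2 (cid (XY n)).
have f_d n x : cd n (f n x) = f (n + 1) (cd n x) by rewrite dX dY linear0.
pose F : chain_map X Y := ChainMap f_d.
have F_qi : quasi_iso F := @bijective_quasi_iso X Y F fP.
exact: (@span_iso (Db P) I X Y _ (quasi_iso_is_iso F_qi)).
Qed.

Definition concentrated (m : int) (X : complex A) : Prop :=
  forall n, n != m -> trivial_module (X n).

Lemma isomorphic_refl (M : lmodType A) : isomorphic M M.
Proof. by exists (idfun : {linear M -> M}); split=> // y; exists y. Qed.

Lemma isomorphic_trivial (M N : lmodType A) :
  trivial_module M -> trivial_module N -> isomorphic M N.
Proof.
move=> M0 N0; exists (\0 : {linear M -> N}); split=> [x y _ | y].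
  by rewrite [x]M0 [y]M0.
by exists 0; rewrite [RHS]N0.
Qed.

Section SingleDegree.

Variables (M : lmodType A) (m : int).

Definition single_ob (n : int) : lmodType A := if n == m then M else 'rV[A]_0.

Lemma single_dd n (x : single_ob n) :
  (\0 : single_ob (n + 1) -> single_ob (n + 1 + 1))
    ((\0 : single_ob n -> single_ob (n + 1)) x) = 0.
Proof. by []. Qed.

Definition single_complex : complex A := @Complex A single_ob (fun n => \0) single_dd.

Lemma single_concentrated : concentrated m single_complex.
Proof. by move=> n /negPf nm; rewrite /= /single_ob nm; exact: trivial_rV0. Qed.

Lemma single_bounded : is_bounded single_complex.
Proof. by exists `|m|%N => n nm; apply: single_concentrated; lia. Qed.

Lemma single_class : P M -> forall n, P (single_complex n).
Proof. by move=> PM n /=; rewrite /single_ob; case: ifP => // _; exact: in_class0. Qed.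

Lemma single_graded : is_projective M -> graded_projective single_complex.
Proof.
move=> M_proj; split=> // n /=; rewrite /single_ob; case: ifP => // _.
exact/projective_trivial/trivial_rV0.
Qed.

End SingleDegree.

Lemma shift_graded X : graded_projective X -> graded_projective (bshift X).
Proof.
by move=> [X_proj dX]; split=> n => [|x]; [exact: X_proj | rewrite /= dX oppr0].
Qed.

(** The degree is moved to 0, the degree of a stalk, one shift at a time. *)
Lemma concentrated_span m X :
  graded_projective X -> concentrated m X -> span I (X : Db P).
Proof.
have at0 X' : graded_projective X' -> concentrated 0 X' -> span I (X' : Db P).
  move=> X_gp X0; have PX0 := bc_class X' 0.
  have St_gp : graded_projective (bstalk PX0).
    split=> // -[[|n]|n] /=; first exact: X_gp.1.
      exact/projective_trivial/trivial_rV0.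
    exact/projective_trivial/trivial_rV0.
  apply: graded_iso_span St_gp X_gp _ (stalk_span PX0 (X_gp.1 0)).
  case=> [[|n]|n]; first exact: isomorphic_refl.
    exact: isomorphic_trivial (@trivial_rV0 A) (X0 _ _).
  exact: isomorphic_trivial (@trivial_rV0 A) (X0 _ _).
have [n [-> | ->]] : exists n : nat, m = n \/ m = - (n : int).
  by exists `|m|%N; lia.
  elim: n X => [|n IHn] X X_gp Xm; first exact: at0.
  apply: span_unshift; apply: IHn (shift_graded X_gp) _ => j jn.
  by apply: Xm; lia.
elim: n X => [|n IHn] X X_gp Xm; first by apply: at0; rewrite // -oppr0.
set M := X (- n.+1%:Z); have PM : P M := bc_class X _.
pose Y := BoundedComplex (single_bounded M (- n%:Z)) (single_class (- n%:Z) PM).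
have Y_gp : graded_projective Y by apply: single_graded; exact: X_gp.1.
apply: graded_iso_span (shift_graded Y_gp) X_gp _ _; last first.
  by apply: span_shift; apply: IHn Y_gp _; exact: single_concentrated.
move=> j /=; rewrite /single_ob; have [-> | jn] := eqVneq j (- n.+1%:Z).
  by rewrite (_ : _ == _ = true); [exact: isomorphic_refl | lia].
rewrite (_ : _ == _ = false); last by lia.
exact: isomorphic_trivial (@trivial_rV0 A) (Xm _ _).
Qed.

(** A bounded graded module is the coproduct of its finitely many homogeneous
    components. *)
Section Components.

Variables (Q : bounded_complex P) (Q_gp : graded_projective Q).

Definition component_ob (m n : int) : lmodType A := if n == m then Q n else 'rV[A]_0.

Lemma component_dd m n (x : component_ob m n) :
  (\0 : component_ob m (n + 1) -> component_ob m (n + 1 + 1))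
    ((\0 : component_ob m n -> component_ob m (n + 1)) x) = 0.
Proof. by []. Qed.

Definition component m : complex A :=
  @Complex A (component_ob m) (fun n => \0) (@component_dd m).

Lemma component_concentrated m : concentrated m (component m).
Proof. by move=> n /negPf nm; rewrite /= /component_ob nm; exact: trivial_rV0. Qed.

Lemma component_bounded m : is_bounded (component m).
Proof. by exists `|m|%N => n nm; apply: component_concentrated; lia. Qed.

Lemma component_class m n : P (component m n).
Proof.
by rewrite /= /component_ob; case: ifP => _; [exact: bc_class | exact: in_class0].
Qed.

Definition bcomponent m : bounded_complex P :=
  BoundedComplex (component_bounded m) (component_class m).

Lemma component_graded m : graded_projective (bcomponent m).
Proof.
split=> // n /=; rewrite /component_ob; case: ifP => _; first exact: Q_gp.1.
exact/projective_trivial/trivial_rV0.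
Qed.

Definition component_in m n : {linear component_ob m n -> Q n} :=
  if n == m as b return {linear (if b then Q n else 'rV[A]_0 : lmodType A) -> Q n}
  then idfun else \0.

Definition component_out m n : {linear Q n -> component_ob m n} :=
  if n == m as b return {linear Q n -> (if b then Q n else 'rV[A]_0 : lmodType A)}
  then idfun else \0.

Lemma component_inK m n : cancel (component_in m n) (component_out m n).
Proof.
rewrite /component_in /component_out /component_ob.
by case: (n == m) => x //=; rewrite [RHS]trivial_rV0.
Qed.

Lemma component_outK n : cancel (component_out n n) (component_in n n).
Proof. by rewrite /component_in /component_out /component_ob eqxx. Qed.

Lemma component_in_d m n (x : component m n) :
  cd n (component_in m n x) = component_in m (n + 1) (cd n x).
Proof. by rewrite Q_gp.2 /= linear0. Qed.

Definition component_map m : chain_map (bcomponent m) Q :=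
  @ChainMap A (component m) Q (component_in m) (@component_in_d m).

Lemma graded_projective_span : span I (Q : Db P).
Proof.
have [N QN] := bc_bounded Q; pose deg (s : 'I_(N + N).+1) := s%:Z - N%:Z.
apply: (@span_sum (Db P) I _ (fun s => bcomponent (deg s))) => [s|].
  exact: concentrated_span (component_graded _) (@component_concentrated _).
exists (fun s => quot_map (component_map (deg s))).
apply: graded_coproduct => [s|//|n]; first exact: component_graded.
have big_n x : (N < `|n|)%N -> x = 0 :> Q n by move=> /QN.
split=> [M u | M w w' ww' x]; last first.
  have [lt_Nn | n_small] := ltnP N `|n|; first by rewrite [x]big_n // !linear0.
  have sP : (absz (n + N%:Z)%R < (N + N).+1)%N by lia.
  have degs : deg (Ordinal sP) = n by rewrite /deg /=; lia.
  have := ww' (Ordinal sP) (component_out (deg (Ordinal sP)) n x).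
  by rewrite /= degs component_outK.
have wL : linear (fun x : Q n => \sum_s u s (component_out (deg s) n x)).
  move=> a x y; rewrite scaler_sumr -big_split; apply: eq_bigr => s _.
  by rewrite !linearP.
exists (mklinear wL) => s x; rewrite /= (bigD1 s) //= component_inK big1 ?addr0 //.
move=> t ts; have [nt | nt] := eqVneq n (deg t); last first.
  by rewrite [component_out _ _ _](component_concentrated nt) linear0.
have ns : n != deg s.
  apply: contra ts => /eqP ns; apply/eqP/val_inj => /=.
  by move: nt; rewrite ns /deg; lia.
by rewrite [x](component_concentrated ns) !linear0.
Qed.

End Components.

End GradedGeneration.

End DerivedGeneration.

(** * Attaching a graded projective module *)

(** The components of a map g from Q to the cone of f are a map from Q to F[1], used to
    twist the sum of Q and F into an extension of Q by F, and a null homotopy of its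
    composite with f, used to extend f. *)
Section Attach.

Variables (A : pzRingType) (F X : complex A) (f : chain_map F X).
Variables (Q : int -> lmodType A) (g : forall n, {linear Q n -> cone f n}).
Hypothesis g_cycle : forall n q, cd n (g n q) = 0.

Lemma graded_dd n (q : Q n) :
  (\0 : Q (n + 1) -> Q (n + 1 + 1)) ((\0 : Q n -> Q (n + 1)) q) = 0.
Proof. by []. Qed.

Definition graded_complex : complex A := @Complex A Q (fun n => \0) graded_dd.

Lemma attach_map_d n (q : graded_complex n) : cd n (g n q) = g (n + 1) (cd n q).
Proof. by rewrite g_cycle linear0. Qed.

Definition attaching_map : chain_map graded_complex (cone f) :=
  @ChainMap A graded_complex (cone f) g attach_map_d.

Definition attach_ob (n : int) : lmodType A := (Q n * F n)%type.

Definition attach_d n (p : attach_ob n) : attach_ob (n + 1) :=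
  (0, cd n p.2 - (g n p.1).1).

Lemma attach_d_linear n : linear (@attach_d n).
Proof.
move=> a [q x] [q' x']; rewrite /attach_d /= !linearP /=.
by congr (_, _); rewrite /= ?scaler0 ?addr0 // scalerDr addrACA.
Qed.

Lemma cycle_fst n q : cd (n + 1) (g n q).1 = 0.
Proof. by have [/eqP] := g_cycle q; rewrite oppr_eq0 => /eqP. Qed.

Lemma cycle_snd n q : f (n + 1) (g n q).1 + cd n (g n q).2 = 0.
Proof. by have [] := g_cycle q. Qed.

Lemma attach_dd n (p : attach_ob n) :
  mklinear (@attach_d_linear (n + 1)) (mklinear (@attach_d_linear n) p) = 0.
Proof.
by rewrite /= /attach_d /= linearB cdd cycle_fst !linear0 /= !addr0.
Qed.

Definition attach : complex A :=
  @Complex A attach_ob (fun n => mklinear (@attach_d_linear n)) attach_dd.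

Lemma attach_out_linear n : linear (fun p : attach n => (g n p.1).2 + f n p.2 : X n).
Proof. by move=> a p p'; rewrite /= !linearP /= scalerDr addrACA. Qed.

Lemma attach_out_d n (p : attach n) :
  cd n (mklinear (@attach_out_linear n) p) =
  mklinear (@attach_out_linear (n + 1)) (cd n p).
Proof.
rewrite /= /attach_d /= linearD [g _ 0]linear0 add0r linearB cmap_d.
have /eqP := cycle_snd p.1; rewrite addr_eq0 => /eqP ->.
by rewrite opprK; exact: addrC.
Qed.

Definition attach_out : chain_map attach X :=
  @ChainMap A attach X (fun n => mklinear (@attach_out_linear n)) attach_out_d.

Lemma attach_in_linear n : linear (fun x : F n => (0, x) : attach n).
Proof. by move=> a x y; congr (_, _); rewrite /= scaler0 addr0. Qed.

Lemma attach_in_d n (x : F n) :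
  cd n (mklinear (@attach_in_linear n) x : attach n) =
  mklinear (@attach_in_linear (n + 1)) (cd n x).
Proof. by rewrite /= /attach_d /= !linear0 /= addr0. Qed.

Definition attach_in : chain_map F attach :=
  @ChainMap A F attach (fun n => mklinear (@attach_in_linear n)) attach_in_d.

Lemma attach_quot_linear n : linear (fun p : cone attach_in n => p.2.1 : Q n).
Proof. by []. Qed.

Lemma attach_quot_d n (p : cone attach_in n) :
  cd n (mklinear (@attach_quot_linear n) p : graded_complex n) =
  mklinear (@attach_quot_linear (n + 1)) (cd n p).
Proof. by rewrite /= /cone_d /= addr0. Qed.

Definition attach_quot : chain_map (cone attach_in) graded_complex :=
  @ChainMap A (cone attach_in) graded_complex
    (fun n => mklinear (@attach_quot_linear n)) attach_quot_d.

(** The inclusion of F is a degreewise split monomorphism with quotient Q. *)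
Lemma attach_quot_quasi_iso : quasi_iso attach_quot.
Proof.
move=> n; split=> [[x [q x']] /= | q _].
  move=> [_ _ /eqP] dx' [_ q0]; move: dx'; rewrite {}q0 linear0 subr0.
  rewrite addr_eq0 => /eqP xE.
  exists (x', (0, 0)); rewrite /= /cone_d /= /attach_d /= !linear0 !addr0.
  by rewrite xE.
exists ((g (n + 1) q).1, (q, 0)); split; last by exists 0; rewrite /= addr0.
rewrite /= /cone_d /= /attach_d /= cycle_fst !linear0.
by apply: injective_projections => //=; congr (_, _); rewrite /= (addr0, add0r) ?subrr.
Qed.

Lemma attach_assoc_linear n : linear (fun p : cone attach_out n =>
  (p.1.1, (p.1.2, p.2)) : cone attaching_map n).
Proof. by []. Qed.

Lemma attach_assoc_d n (p : cone attach_out n) :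
  cd n (mklinear (@attach_assoc_linear n) p : cone attaching_map n) =
  mklinear (@attach_assoc_linear (n + 1)) (cd n p).
Proof.
case: p => [[q x] y]; rewrite /= /cone_d /= oppr0.
congr (_, _); apply: injective_projections; rewrite /= ?opprB //.
by rewrite addrA.
Qed.

(** This is the octahedral axiom for the composite F -> attach -> X: the cone of the
    second map is the cone of Q -> cone f, here by an isomorphism of complexes. *)
Definition attach_assoc : chain_map (cone attach_out) (cone attaching_map) :=
  @ChainMap A (cone attach_out) (cone attaching_map)
    (fun n => mklinear (@attach_assoc_linear n)) attach_assoc_d.

Lemma attach_assoc_bij n : injective (attach_assoc n) /\ surjection (attach_assoc n).
Proof.
split=> [[[q x] y] [[q' x'] y'] /= [-> -> ->] // | [q [x y]]].
by exists ((q, x), y).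
Qed.

(** When g is onto in cohomology, the long exact sequence of its cone splits into short
    ones, and leaves the kernel of the map induced by g in the next degree. *)
Lemma cone_cohomology (K : int -> lmodType A) (i : forall n, {linear K n -> Q n}) :
  (forall n, injective (i n)) ->
  (forall n z, cd n z = 0 -> exists q, is_boundary (z - g n q)) ->
  (forall n q, is_boundary (g n q) <-> exists k, i n k = q) ->
  forall m, @is_cohomology A (cone attaching_map) m (K (m + 1))
    (fun k z => cd m z = 0 /\ z.1 = i (m + 1) k).
Proof.
move=> i_inj g_surj giP m; split.
- split=> [|a k k' z z' [dz zk] [dz' zk']]; first by rewrite !linear0.
  by split; [rewrite linearP dz dz' scaler0 addr0 | rewrite /= zk zk' linearP].
- by move=> k z [].
- move=> z dz; have /eqP : g (m + 1) z.1 + cd m z.2 = 0 := congr1 snd dz.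
  rewrite addr_eq0 => /eqP gz.
  have /giP [k ik] : is_boundary (g (m + 1) z.1).
    by rewrite gz; apply: boundaryN; exact: IsBoundary.
  by exists k.
- move=> k; have /is_boundaryP [y gy] : is_boundary (g (m + 1) (i (m + 1) k)).
    by apply/giP; exists k.
  exists (i (m + 1) k, - y); split=> //.
  apply: injective_projections; first by rewrite /= oppr0.
  by rewrite -[LHS]/(g (m + 1) (i (m + 1) k) + cd m (- y)) linearN gy subrr.
move=> k z [dz zk]; have [n e] := int_succ m; subst m.
split=> [k0 | /is_boundaryP [w zw]]; last first.
  by apply: (i_inj (n + 1 + 1)); rewrite linear0 -zk zw /= oppr0.
have z1 : z.1 = 0 by rewrite zk k0 linear0.
have : g (n + 1 + 1) z.1 + cd (n + 1) z.2 = 0 := congr1 snd dz.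
rewrite z1 linear0 add0r => /g_surj [q /is_boundaryP [y zy]].
apply/is_boundaryP; exists (q, y).
apply: injective_projections; first by rewrite /= oppr0.
by rewrite -[RHS]/(g (n + 1) q + cd n y) -zy [RHS]addrC subrK.
Qed.

End Attach.

(** * Stalk complexes *)

Section Stalks.

Variables (A : pzRingType) (P : module_class A).

Definition stalk_linear (M N : lmodType A) (f : {linear M -> N}) n :
    {linear stalk_ob M n -> stalk_ob N n} :=
  match n as n return {linear stalk_ob M n -> stalk_ob N n} with
  | Posz 0 => f
  | _ => \0
  end.

Lemma stalk_linear_d (M N : lmodType A) (f : {linear M -> N}) n (x : stalk M n) :
  cd n (stalk_linear f n x : stalk N n) = stalk_linear f (n + 1) (cd n x).
Proof. by rewrite /= linear0. Qed.

Definition stalk_map (M N : lmodType A) (f : {linear M -> N}) :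
    chain_map (stalk M) (stalk N) :=
  @ChainMap A (stalk M) (stalk N) (stalk_linear f) (@stalk_linear_d M N f).

Lemma stalk_graded (M : lmodType A) : is_projective M -> graded_projective (stalk M).
Proof.
by move=> M_proj; split=> // -[[|n]|n] //=; exact/projective_trivial/trivial_rV0.
Qed.

Lemma stalk_direct_sum (S : Type) (F : S -> lmodType A) (Z : lmodType A)
    (PF : forall s, P (F s)) (PZ : P Z) (i : forall s, {linear F s -> Z}) :
  (forall s, is_projective (F s)) -> is_projective Z -> linear_coproduct i ->
  @is_direct_sum (Db_cat P) S (fun s => bstalk (PF s)) (bstalk PZ).
Proof.
move=> F_proj Z_proj i_cop.
exists (fun s => @quot_map A P (bstalk (PF s)) (bstalk PZ) (stalk_map (i s))).
apply: graded_coproduct => [s||n]; [exact: stalk_graded|exact: stalk_graded|].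
case: n => [[|n]|n] //=.
  split=> [M u | M w w' _ x]; last by rewrite [x]trivial_rV0 !linear0.
  by exists \0 => s x; rewrite [x]trivial_rV0 !linear0.
split=> [M u | M w w' _ x]; last by rewrite [x]trivial_rV0 !linear0.
by exists \0 => s x; rewrite [x]trivial_rV0 !linear0.
Qed.

Lemma free_direct_sum (S : Type) (F : lmodType A) (e : S -> F) (PA : P A^o)
    (PF : P F) :
  is_free_on e ->
  @is_direct_sum (Db_cat P) S (fun _ => bstalk PA) (bstalk PF).
Proof.
move=> e_free; have [lift_e ext_e] := e_free.
have iL s : linear (fun a : A^o => (a : A) *: e s : F).
  by move=> a x y; rewrite scalerDl -scalerA.
apply: (stalk_direct_sum (fun=> PA) PF (i := fun s => mklinear (iL s))).
- move=> _; apply: (@free_projective _ unit A^o (fun=> 1)).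
  split=> [M u | M w w' ww' x].
    have wL : linear (fun a : A^o => (a : A) *: u tt : M).
      by move=> a x y; rewrite scalerDl -scalerA.
    by exists (mklinear wL) => -[]; rewrite /= scale1r.
  have := ww' tt; have -> : x = x *: (1 : A^o) by rewrite /GRing.scale /= mulr1.
  by rewrite !linearZ /= => ->.
- exact: free_projective e_free.
split=> [M u | M w w' ww' x].
  have [w wu] := lift_e M (fun s => u s 1); exists w => s a.
  rewrite /= linearZ /= wu -linearZ /=; congr (u s _).
  by rewrite /GRing.scale /= mulr1.
by apply: ext_e => s; have := ww' s 1; rewrite /= scale1r.
Qed.

End Stalks.

(** * The resolution of a complex by graded projective modules *)

Section Resolution.

Variables (A : pzRingType) (P : module_class A) (I : Db P -> Prop).
Implicit Types X Y F : bounded_complex P.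

Hypothesis P_sub : forall (M N : lmodType A) (i : {linear N -> M}),
  injective i -> P M -> P N.
Hypothesis P_quotient : forall (M N : lmodType A) (p : {linear M -> N}),
  surjection p -> P M -> P N.
Hypothesis P_cover : forall M : lmodType A, P M ->
  exists (F : lmodType A) (PF : P F) (p : {linear F -> M}),
    [/\ is_projective F, surjection p & span I (bstalk PF : Db P)].

(** A projective module is a direct summand of its cover, with complement the
    kernel. *)
Lemma projective_stalk_span (M : lmodType A) (PM : P M) :
  is_projective M -> span I (bstalk PM : Db P).
Proof.
move=> M_proj; have [F [PF [p [F_proj p_surj SF]]]] := P_cover PM.
have [K [i [i_inj _ ip]]] := kernel_exists p_surj.
have PK : P K := P_sub i_inj PF.
have [s ps] := M_proj F M p idfun p_surj.
have [|x||r rP] := @linear_of_rel A F K (fun x k => i k = x - s (p x)).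
- split=> [|a x x' y y' xy xy']; first by rewrite !linear0 addr0.
  by rewrite !linearP xy xy' scalerDr addrACA.
- by apply/ip; rewrite linearB ps subrr.
- by move=> k; rewrite !linear0 addr0 => /eqP; rewrite raddf_eq0 // => /eqP.
have pi k : p (i k) = 0 by apply/ip; exists k.
have ri k : r (i k) = k by apply: i_inj; rewrite rP pi !linear0 addr0.
have rs x : r (s x) = 0.
  by apply: i_inj; rewrite rP ps subrr linear0.
have K_proj : is_projective K by apply: projective_retract F_proj ri.
pose G (b : bool) : lmodType A := if b then M else K.
pose j b : {linear G b -> F} := if b as b return {linear G b -> F} then s else i.
pose PG b : P (G b) := if b as b return P (G b) then PM else PK.
have GE : (fun b => bstalk (PG b)) = (fun b : bool => if b then bstalk PM else bstalk PK).
  by apply: funext => -[].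
apply: (@span_summand (Db P) I (bstalk PM) (bstalk PK) _ SF).
rewrite -GE; apply: (stalk_direct_sum PG PF (i := j)) => [[]|//|] //.
split=> [N u | N w w' ww' x].
  have wL : linear (fun x => u true (p x) + u false (r x)).
    by move=> a x y; rewrite !linearP scalerDr addrACA.
  exists (mklinear wL) => -[] x /=; first by rewrite ps rs linear0 addr0.
  by rewrite pi ri linear0 add0r.
have -> : x = s (p x) + i (r x) by rewrite rP addrC subrK.
by rewrite !linearD; congr (_ + _); [exact: ww' true _ | exact: ww' false _].
Qed.

(** Projective dimension less than n, the zero module being of dimension -1. *)
Definition pd_lt (n : nat) (M : lmodType A) : Prop :=
  if n is m.+1 then stable_pd_le m M else trivial_module M.

Lemma pd_lt_trivial n (M : lmodType A) : trivial_module M -> pd_lt n M.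
Proof.
case: n => [//|n] M0; apply: stable_pd_le_of.
elim: n => [|n IHn]; first exact: projective_trivial.
exists M, M, (\0 : {linear M -> M}), (idfun : {linear M -> M}); split=> //.
  exact: projective_trivial.
split=> [x y _|y|x] /=; first by rewrite [x]M0 [y]M0.
  by exists y.
by split=> [->|_]; [exists 0 | exact: M0].
Qed.

(** A projective module covers itself, with kernel zero: this is what ends the
    resolution, and what keeps it zero where the complex is zero. *)
Lemma projective_cover n (H : lmodType A) : P H -> pd_lt n.+1 H ->
  exists (Q K : lmodType A) (i : {linear K -> Q}) (p : {linear Q -> H}),
    [/\ is_projective Q, P Q, short_exact i p, pd_lt n K &
        trivial_module H -> trivial_module Q].
Proof.
move=> PH pdH; have [H_proj | H_nproj] := pselect (is_projective H).
  have rV0 := @trivial_rV0 A.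
  exists H, 'rV[A]_0, (\0 : {linear 'rV[A]_0 -> H}), (idfun : {linear H -> H}).
  split=> //; last exact: pd_lt_trivial.
  split=> [x y _|y|x] /=; first by rewrite [x]rV0 [y]rV0.
    by exists y.
  by split=> [->|[k <-] //]; exists 0.
have [F [PF [p [F_proj p_surj _]]]] := P_cover PH.
have [K [i iP]] := kernel_exists p_surj; exists F, K, i, p; split=> //.
  case: n pdH => [/stable_pd_le0 // | n pdH]; exact: stable_pd_syzygy F_proj iP pdH.
by move=> H0; case: H_nproj; exact: projective_trivial.
Qed.

Definition cohomology_pd_lt (n : nat) (C : complex A) : Prop :=
  forall m, exists (H : lmodType A) (rep : H -> C m -> Prop),
    [/\ is_cohomology rep, P H & pd_lt n H].

(** The first step of a resolution of the cohomology of C in degree m, with the cover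
    lifted to cycles. *)
Record cohomology_cover (n : nat) (C : complex A) (m : int) := CohomologyCover {
  cover_ob : lmodType A;
  cover_ker : lmodType A;
  cover_ker_in : {linear cover_ker -> cover_ob};
  cover_map : {linear cover_ob -> C m};
  cover_projective : is_projective cover_ob;
  cover_class : P cover_ob;
  cover_ker_class : P cover_ker;
  cover_ker_pd : pd_lt n cover_ker;
  cover_ker_inj : injective cover_ker_in;
  cover_cycle : forall q, cd m (cover_map q) = 0;
  cover_surj : forall z, cd m z = 0 -> exists q, is_boundary (z - cover_map q);
  cover_kerP : forall q, is_boundary (cover_map q) <-> exists k, cover_ker_in k = q;
  cover_trivial : trivial_module (C m) -> trivial_module cover_ob
}.

Lemma cohomology_cover_exists n (C : complex A) :
  cohomology_pd_lt n.+1 C -> exists D : forall m, cohomology_cover n C m, True.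
Proof.
move=> C_pd; suff D m : exists D : cohomology_cover n C m, True.
  by exists (fun m => projT1 (cid (D m))).
have [H [rep [repP PH pdH]]] := C_pd m.
have [repL repZ repC repT repB] := repP.
have [Q [K [i [p [Q_proj PQ [i_inj p_surj ip] pdK Q0]]]]] := projective_cover PH pdH.
have [||g gP] := @projective_choice A Q (C m) (fun q z => rep (p q) z) Q_proj.
- split=> [|a x x' y y' xy xy']; first by rewrite linear0; exact: repL.1.
  by rewrite linearP; exact: repL.2.
- by move=> q; exact: repT.
have PK : P K by exact: P_sub i_inj PQ.
unshelve eexists (@CohomologyCover n C m Q K i g Q_proj PQ PK pdK i_inj _ _ _ _) => //.
- by move=> q; exact: repZ (gP q).
- move=> z /repC [h hz]; have [q qh] := p_surj h; exists q.
  apply/(repB 0) => //; have := repL.2 (-1) _ _ _ _ (gP q) hz.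
  by rewrite qh !scaleN1r addNr [- _ + _]addrC.
- by move=> q; rewrite -(repB _ _ (gP q)).
move=> C0; apply: Q0 => h; have [z hz] := repT h; apply/(repB _ _ hz).
by rewrite [z]C0; exact: boundary0.
Qed.

(** F' is obtained from F by attaching covers of the cohomology of the cone of f in all
    degrees; in the derived category, the cone of F -> F' is isomorphic to the graded
    module of these covers. *)
Lemma resolution_step n j F X (f : chain_map F X) :
  cohomology_pd_lt n.+1 (cone f) -> span_iter I j (F : Db P) ->
  exists (F' : bounded_complex P) (f' : chain_map F' X),
    cohomology_pd_lt n (cone f') /\ span_iter I j.+1 (F' : Db P).
Proof.
move=> f_pd SF; have [D _] := cohomology_cover_exists f_pd.
pose Q m := cover_ob (D m); pose g m := cover_map (D m).
have g_cycle m q : cd m (g m q) = 0 := @cover_cycle _ _ _ (D m) q.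
have Q_bounded : is_bounded (graded_complex Q).
  have [N CN] := bc_bounded (bcone f); exists N => m mN.
  by apply: (cover_trivial (c := D m)); exact: CN m mN.
pose Qc : bounded_complex P := BoundedComplex Q_bounded (fun m => cover_class (D m)).
have F'_bounded : is_bounded (attach g_cycle).
  have [N QN] := Q_bounded; have [N' FN] := bc_bounded F; exists (N + N')%N.
  by move=> m mN [q x]; congr (_, _); [apply: QN | apply: FN]; lia.
pose F' : bounded_complex P :=
  BoundedComplex F'_bounded (fun m => in_classD (cover_class (D m)) (bc_class F m)).
pose f' : chain_map F' X := attach_out g_cycle; exists F', f'; split.
  move=> m; exists (cover_ker (D (m + 1))); eexists.
  split; [|exact: cover_ker_class|exact: cover_ker_pd].
  apply: is_cohomology_iso (attach_assoc_bij g_cycle) _.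
  apply: (cone_cohomology g_cycle (i := fun m => cover_ker_in (D m))) => n'.
  - exact: cover_ker_inj.
  - exact: cover_surj.
  - exact: cover_kerP.
pose incl : chain_map F F' := attach_in g_cycle.
apply: (@span_iter_cone A P I j F F' incl SF).
have Q_span : span I (Qc : Db P).
  apply: (graded_projective_span projective_stalk_span).
  by split=> [m | //]; exact: (cover_projective (c := D m)).
have [h [qh hq]] := @quasi_iso_is_iso A P (bcone incl) Qc (attach_quot g_cycle)
  (attach_quot_quasi_iso g_cycle).
apply: (@span_iso (Db P) I Qc (bcone incl) h _ Q_span).
by exists (@quot_map A P (bcone incl) Qc (attach_quot g_cycle)).
Qed.

Lemma resolution_span n j F X (f : chain_map F X) :
  cohomology_pd_lt n (cone f) -> span_iter I j (F : Db P) ->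
  span_iter I (j + n) (X : Db P).
Proof.
elim: n j F f => [|n IHn] j F f f_pd SF.
  rewrite addn0; apply: (@span_iter_iso (Db P) I j F X _ _ SF).
  apply: quasi_iso_is_iso; apply: quasi_iso_of_cone => m z dz.
  have [H [rep [[_ _ repC _ repB] _ H0]]] := f_pd m; have [h hz] := repC z dz.
  by apply/(repB h z hz); exact: H0.
have [F' [f' [f'_pd SF']]] := resolution_step f_pd SF.
by rewrite addnS -addSn; exact: IHn f'_pd SF'.
Qed.

Theorem span_iter_gldim d X :
  (forall M : lmodType A, pd_le d M) -> span_iter I d.+1 (X : Db P).
Proof.
move=> pd_d; pose O := bstalk (in_class0 P).
have O0 n : trivial_module (O n) by case: n => [[|n]|n] x; exact: trivial_rV0.
have zero_d n (x : O n) : cd n ((\0 : O n -> X n) x) = (\0 : O (n + 1) -> X (n + 1)) (cd n x).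
  exact: linear0.
pose z := @ChainMap A O X (fun n => \0) zero_d.
have -> : d.+1 = (0 + d.+1)%N by [].
apply: (@resolution_span _ _ O X z); last exact: trivial_is_zero.
move=> m; have [Z [H [i [p [rep [i_inj p_surj repP]]]]]] := cohomology_exists (cone z) m.
exists H, rep; split=> //; last exact: stable_pd_le_of.
exact: P_quotient p_surj (P_sub i_inj (bc_class (bcone z) m)).
Qed.

End Resolution.

(** * Noetherian rings *)

Section RelativeNoetherian.

(** Everything is relative to a subring R of A, given as a predicate, so that the
    rings k[x_1, ..., x_i] can be handled inside a fixed algebra. *)
Variable A : pzRingType.
Implicit Types (R : A -> Prop) (M : lmodType A).

Definition is_subring R : Prop :=
  [/\ R 1, forall x y, R x -> R y -> R (x - y) & forall x y, R x -> R y -> R (x * y)].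

Definition submodule_over R M (N : M -> Prop) : Prop :=
  [/\ N 0, forall x y, N x -> N y -> N (x + y) &
      forall a x, R a -> N x -> N (a *: x)].

Fixpoint combination R M (s : seq M) (x : M) : Prop :=
  if s is e :: s' then
    exists a y, [/\ R a, combination R s' y & x = a *: e + y]
  else x = 0.

Definition generated_over R M (N : M -> Prop) (s : seq M) : Prop :=
  (forall x, x \in s -> N x) /\ (forall x, N x -> combination R s x).

Definition noetherian R : Prop :=
  forall J : A^o -> Prop, submodule_over R J -> (forall x, J x -> R x) ->
  exists s, generated_over R J s.

Lemma combination_mono R (R' : A -> Prop) M (s : seq M) x :
  (forall a, R a -> R' a) -> combination R s x -> combination R' s x.
Proof.
move=> RR'; elim: s x => //= e s IHs x [a [y [Ra sy ->]]].
by exists a, y; split; [exact: RR' | exact: IHs |].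
Qed.

Lemma combination_sum R M (I : Type) (r : seq I) (a : I -> A) (e : I -> M) :
  (forall i, R (a i)) -> combination R [seq e i | i <- r] (\sum_(i <- r) a i *: e i).
Proof.
move=> Ra; elim: r => [|i r IHr] /=; first by rewrite big_nil.
by exists (a i), (\sum_(j <- r) a j *: e j); rewrite big_cons.
Qed.

Lemma combination_index R M (s : seq M) x :
  combination R s x -> exists a : 'I_(size s) -> A, x = \sum_i a i *: s`_i.
Proof.
elim: s x => [|e s IHs] x /= => [-> | [a [y [_ /IHs [b ->] ->]]]].
  by exists (fun=> 0); rewrite big_ord0.
exists (fun i => oapp b a (unlift ord0 i)); rewrite big_ord_recl unlift_none /=.
by congr (_ + _); apply: eq_bigr => i _; rewrite liftK.
Qed.

Lemma combination_map R M (N : lmodType A) (f : {linear N -> M}) (t : seq N) y :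
  combination R [seq f z | z <- t] y -> exists2 x, combination R t x & y = f x.
Proof.
elim: t y => [|e t IHt] y /= => [-> | [a [z [Ra /IHt [x tx ->] ->]]]].
  by exists 0; rewrite ?linear0.
by exists (a *: e + x); [exists a, x | rewrite linearP].
Qed.

Lemma combination_min R M (N : M -> Prop) (s : seq M) x :
  submodule_over R N -> (forall z, z \in s -> N z) -> combination R s x -> N x.
Proof.
move=> [N0 ND NZ]; elim: s x => [|e s IHs] x sN /= => [-> // | [a [y [Ra sy ->]]]].
apply: ND; first by apply: NZ Ra _; apply: sN; exact: mem_head.
by apply: IHs sy => z sz; apply: sN; rewrite inE sz orbT.
Qed.

Section Subring.

Variables (R : A -> Prop) (R_ring : is_subring R).

Lemma subring1 : R 1. Proof. by case: R_ring. Qed.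
Lemma subringB x y : R x -> R y -> R (x - y).
Proof. by case: R_ring => _ + _; exact. Qed.
Lemma subringM x y : R x -> R y -> R (x * y).
Proof. by case: R_ring => _ _; exact. Qed.
Lemma subring0 : R 0.
Proof. by rewrite -(subrr 1); exact: subringB subring1 subring1. Qed.
Lemma subringN x : R x -> R (- x).
Proof. by rewrite -sub0r; exact: subringB subring0. Qed.
Lemma subringD x y : R x -> R y -> R (x + y).
Proof. by move=> Rx /subringN; rewrite -[y in R (_ + y)]opprK; exact: subringB. Qed.

Lemma combination_submodule M (s : seq M) : submodule_over R (combination R s).
Proof.
split; elim: s => [|e s IHs] //=.
- by exists 0, 0; rewrite scale0r addr0; split=> //; exact: subring0.
- by move=> x y -> ->; rewrite addr0.
- move=> x y [a [x' [Ra sx ->]]] [b [y' [Rb sy ->]]].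
  exists (a + b), (x' + y'); rewrite scalerDl addrACA.
  by split; [exact: subringD | exact: IHs |].
- by move=> a x _ ->; rewrite scaler0.
move=> a x Ra [b [y [Rb sy ->]]]; exists (a * b), (a *: y).
by rewrite scalerDr scalerA; split; [exact: subringM | exact: IHs |].
Qed.

Lemma combination_mem M (s : seq M) x : x \in s -> combination R s x.
Proof.
elim: s => [//|e s IHs]; rewrite inE => /orP [/eqP -> | /IHs sx] /=.
  exists 1, 0; rewrite scale1r addr0; split=> //; first exact: subring1.
  by have [] := combination_submodule s.
by exists 0, x; rewrite scale0r add0r; split=> //; exact: subring0.
Qed.

Lemma combination_sub M (s t : seq M) x :
  {subset s <= t} -> combination R s x -> combination R t x.
Proof.
move=> st; apply: combination_min; first exact: combination_submodule.
by move=> z /st; exact: combination_mem.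
Qed.

Lemma submodule_overB M (N : M -> Prop) x y :
  submodule_over R N -> N x -> N y -> N (x - y).
Proof.
move=> [_ ND NZ] Nx Ny; apply: ND Nx _; rewrite -scaleN1r; apply: NZ Ny.
exact: subringN subring1.
Qed.

(** Coefficients of e in the elements of N that lie in R e + <s>: with e = x^n and s
    the lower powers of x, the leading coefficients of the polynomials of degree n in
    an ideal. *)
Definition leading M (N : M -> Prop) (s : seq M) (e : M) (r : A^o) : Prop :=
  R r /\ exists2 y, combination R s y & N ((r : A) *: e + y).

Lemma leading_submodule M (N : M -> Prop) s e :
  submodule_over R N -> submodule_over R (leading N s e).
Proof.
move=> [N0 ND NZ]; have [s0 sD sZ] := combination_submodule s; split.
- by split; [exact: subring0 | exists 0; rewrite // scale0r addr0].
- move=> r r' [Rr [y sy Ny]] [Rr' [y' sy' Ny']]; split; first exact: subringD.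
  by exists (y + y'); [exact: sD | rewrite scalerDl addrACA; exact: ND].
move=> a r Ra [Rr [y sy Ny]]; split; first exact: subringM.
by exists (a *: y); [exact: sZ | rewrite -scalerA -scalerDr; exact: NZ].
Qed.

(** Generators l of an ideal of leading coefficients lift to elements u of N, whose
    combinations then cancel the e-component of any element with leading coefficient
    in the ideal. *)
Lemma leading_lift M (N : M -> Prop) s e (l : seq A^o) :
  (forall r, r \in l -> leading N s e r) ->
  exists2 u : seq M, (forall z, z \in u -> N z) &
    forall r, combination R l r ->
      exists2 z, combination R u z & combination R s (z - (r : A) *: e).
Proof.
have [s0 sD sZ] := combination_submodule s.
elim: l => [|r l IHl] lN.
  exists [::] => // r /= ->; exists 0 => //.
  by rewrite scale0r subr0.
have [|u uN u_lift] := IHl; first by move=> r' lr'; apply: lN; rewrite inE lr' orbT.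
have [Rr [y sy Ny]] := lN r (mem_head _ _); exists ((r : A) *: e + y :: u).
  by move=> z; rewrite inE => /orP [/eqP -> | /uN].
move=> _ [a [r' [Ra /u_lift [z uz sz] ->]]].
exists (a *: ((r : A) *: e + y) + z); first by exists a, z.
have -> : a *: ((r : A) *: e + y) + z - ((a *: r + r' : A^o) : A) *: e =
          a *: y + (z - (r' : A) *: e).
  by rewrite scalerDl scalerDr scalerA opprD -[_ + z]addrA addrACA subrr add0r addrA.
by apply: sD sz; exact: sZ.
Qed.

(** Submodules of finitely generated modules are finitely generated: the coefficients
    of the first generator form an ideal, and the elements in which it does not occur
    are handled by induction. *)
Lemma noetherian_module M (N : M -> Prop) s :
  noetherian R -> submodule_over R N -> (forall x, N x -> combination R s x) ->
  exists t, generated_over R N t.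
Proof.
move=> R_noeth; elim: s N => [|e s IHs] N N_sub sN.
  by exists [::]; split.
have L_sub := leading_submodule s e N_sub.
have [l [lL l_gen]] := R_noeth _ L_sub (fun r => @proj1 _ _).
have [u uN u_lift] := leading_lift lL.
have [s0 sD sZ] := combination_submodule s; have [N0 ND NZ] := N_sub.
have [|//|t [tN t_gen]] := IHs (fun x => N x /\ combination R s x).
- by split=> // [x y [? ?] [? ?]|a x ? [? ?]]; split; auto.
- by move=> x [].
exists (u ++ t); split=> [x | x Nx].
  by rewrite mem_cat => /orP [/uN | /tN []].
have [a [y [Ra sy xE]]] := sN x Nx.
have [|z uz sz] := u_lift a.
  by apply: l_gen; split=> //; exists y; rewrite -?xE.
have /t_gen tz : N (x - z) /\ combination R s (x - z).
  split; first by apply: submodule_overB => //; exact: combination_min N_sub uN uz.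
  have -> : x - z = y - (z - a *: e) by rewrite xE opprB addrA [y + _]addrC.
  by apply: submodule_overB sy sz; exact: combination_submodule.
have [_ utD _] := combination_submodule (u ++ t); rewrite -[x](subrK z); apply: utD.
  by apply: combination_sub tz => w tw; rewrite mem_cat tw orbT.
by apply: combination_sub uz => w uw; rewrite mem_cat uw.
Qed.

End Subring.

End RelativeNoetherian.

Section HilbertBasis.

Variables (B : comPzRingType) (R : B -> Prop) (x : B).
Hypothesis R_ring : is_subring R.

(** In decreasing order, so that the head is the leading monomial. *)
Fixpoint powers (n : nat) : seq B^o :=
  if n is m.+1 then (x ^+ m : B^o) :: powers m else [::].

(** The subring R[x], filtered by the degree. *)
Definition adjoined (b : B) : Prop := exists n, combination R (powers n) b.

Lemma powers_mono m n : (m <= n)%N -> {subset powers m <= powers n}.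
Proof.
elim: n => [|n IHn]; first by rewrite leqn0 => /eqP ->.
rewrite leq_eqVlt => /orP [/eqP -> // | /IHn sub_mn] z /sub_mn.
by rewrite inE orbC => ->.
Qed.

Lemma combination_powers_mono m n (b : B^o) :
  (m <= n)%N -> combination R (powers m) b -> combination R (powers n) b.
Proof. by move=> /powers_mono; exact: combination_sub. Qed.

Lemma combination_powersX n (b : B^o) :
  combination R (powers n) b -> combination R (powers n.+1) (x * b : B^o).
Proof.
elim: n b => [|n IHn] b.
  by move=> /= ->; exists 0, 0; rewrite mulr0 scale0r addr0; split=> //; exact: subring0.
move=> [a [y [Ra sy ->]]]; exists a, (x * y : B^o); split=> //; first exact: IHn.
by rewrite mulrDr /GRing.scale /= exprS mulrCA.
Qed.

Lemma combination_powersXn k n (b : B^o) :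
  combination R (powers n) b -> combination R (powers (k + n)) (x ^+ k * b : B^o).
Proof.
move=> nb; elim: k => [|k IHk]; first by rewrite mul1r.
by rewrite addSn exprS -mulrA; exact: combination_powersX.
Qed.

Lemma subring_adjoined a : R a -> adjoined a.
Proof.
move=> Ra; exists 1%N, a, 0; split=> //.
by rewrite addr0 /GRing.scale /= mulr1.
Qed.

Lemma adjoined_gen : adjoined x.
Proof.
exists 2%N; apply: (combination_mem R_ring).
by rewrite inE expr1 eqxx.
Qed.

Lemma adjoined_submodule : submodule_over R (adjoined : B^o -> Prop).
Proof.
split=> [|b c [m mb] [n nc]|a b Ra [n nb]]; first by exists 0%N.
  exists (maxn m n); have [_ addP _] := combination_submodule R_ring (powers (maxn m n)).
  apply: addP; first exact: combination_powers_mono (leq_maxl _ _) mb.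
  exact: combination_powers_mono (leq_maxr _ _) nc.
by exists n; have [_ _ sP] := combination_submodule R_ring (powers n); exact: sP.
Qed.

Lemma adjoined_ring : is_subring adjoined.
Proof.
have [S0 SD SZ] := adjoined_submodule.
split; first exact: subring_adjoined (subring1 R_ring).
  by move=> b c; exact: (submodule_overB R_ring adjoined_submodule).
move=> b c [n nb] Sc; elim: n b nb => [b /= ->|n IHn b [a [y [Ra /IHn Sy ->]]]].
  by rewrite mul0r.
rewrite mulrDl; apply: SD => //.
have -> : a *: (x ^+ n : B^o) * c = a *: (x ^+ n * c : B^o).
  by rewrite /GRing.scale /= mulrA.
apply: SZ => //.
by have [m mc] := Sc; exists (n + m)%N; exact: combination_powersXn.
Qed.

(** Hilbert's basis theorem. The leading coefficients of the elements of an ideal J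
    of R[x] form an ideal of R whose generators occur in some degree N; above N they
    reduce the degree, and below N the ideal J is a submodule of R^N. *)
Lemma noetherian_adjoined : noetherian R -> noetherian adjoined.
Proof.
move=> R_noeth J J_sub J_adj; have [J0 JD JZ] := J_sub.
have JR_sub : submodule_over R J.
  by split=> // a b Ra; apply: JZ; exact: subring_adjoined.
pose lead n := leading R J (powers n) (x ^+ n : B^o).
have lead_sub n : submodule_over R (lead n) by exact: leading_submodule.
have leadS n r : lead n r -> lead n.+1 r.
  move=> [Rr [y ny Jy]]; split=> //; exists (x * y : B^o); first exact: combination_powersX.
  have -> : (r : B) *: (x ^+ n.+1 : B^o) + x * y = x *: ((r : B) *: (x ^+ n : B^o) + y).
    by rewrite /GRing.scale /= mulrDr exprS mulrCA.
  by apply: JZ => //; exact: adjoined_gen.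
have lead_mono m n r : (m <= n)%N -> lead m r -> lead n r.
  move=> le_mn; rewrite -(subnK le_mn); elim: (n - m)%N => [//|k IHk] /IHk.
  exact: leadS.
have [||l [lL l_gen]] := R_noeth (fun r => exists n, lead n r).
- split=> [|r r' [m mr] [n nr']|a r Ra [n nr]].
  + by exists 0%N; have [] := lead_sub 0%N.
  + exists (maxn m n); have [_ addP _] := lead_sub (maxn m n).
    by apply: addP; [exact: lead_mono (leq_maxl _ _) mr | exact: lead_mono (leq_maxr _ _) nr'].
  + by exists n; have [_ _ sP] := lead_sub n; exact: sP.
- by move=> r [n []].
have [N lN] : exists N, forall r, r \in l -> lead N r.
  elim: (l) lL => [|r l' IHl] lL; first by exists 0%N.
  have [|N lN] := IHl; first by move=> r' l'r'; apply: lL; rewrite inE l'r' orbT.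
  have [n nr] := lL r (mem_head _ _); exists (maxn n N) => r'.
  rewrite inE => /orP [/eqP -> | /lN]; first exact: lead_mono (leq_maxl _ _) nr.
  exact/lead_mono/leq_maxr.
have [u uJ u_lift] := leading_lift R_ring lN.
have [sN0 sND sNZ] := combination_submodule R_ring (powers N).
have [||t [tJ t_gen]] := @noetherian_module _ _ R_ring _
    (fun b => J b /\ combination R (powers N) b) (powers N) R_noeth.
- split=> [|b c [Jb nb] [Jc nc]|a b Ra [Jb nb]]; first by split.
    by split; [exact: JD | exact: sND].
  by split; [apply: JZ => //; exact: subring_adjoined | exact: sNZ].
- by move=> b [].
have adj_sub s := combination_submodule adjoined_ring (s : seq B^o).
have up (s : seq B^o) b : {subset s <= u ++ t} -> combination R s b ->
    combination adjoined (u ++ t) b.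
  move=> sut sb; apply: (combination_sub adjoined_ring sut).
  by apply: combination_mono sb; exact: subring_adjoined.
have u_up : {subset u <= u ++ t} by move=> z uz; rewrite mem_cat uz.
have t_up : {subset t <= u ++ t} by move=> z tz; rewrite mem_cat tz orbT.
exists (u ++ t); split=> [b | b Jb].
  by rewrite mem_cat => /orP [/uJ | /tJ []].
have [n nb] := J_adj b Jb; elim: n b Jb nb => [|n IHn] b Jb nb.
  by rewrite /= in nb; rewrite nb; have [] := adj_sub (u ++ t).
have [lt_nN | le_Nn] := ltnP n N.
  apply: (up t) => //; apply: t_gen; split=> //; exact: combination_powers_mono nb.
have [a [y [Ra ny bE]]] := nb.
have [|z uz Nz] := u_lift a.
  by apply: l_gen; exists n; split=> //; exists y; rewrite -?bE.
have z_adj : combination adjoined (u ++ t) (x ^+ (n - N) * z : B^o).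
  have [_ _ sP] := adj_sub (u ++ t); apply: sP (up u z u_up uz).
  have one1 : combination R (powers 1) (1 : B^o).
    by apply: (combination_mem R_ring); exact: mem_head.
  have Xs := combination_powersXn (n - N) one1.
  by rewrite mulr1 in Xs; exists (n - N + 1)%N.
have Jz : J (x ^+ (n - N) * z : B^o).
  by apply: combination_min J_sub _ z_adj => w; rewrite mem_cat => /orP [/uJ | /tJ []].
have [_ addP _] := adj_sub (u ++ t); rewrite -[b](subrK (x ^+ (n - N) * z : B^o)).
apply: addP z_adj; apply: IHn; first exact: (submodule_overB adjoined_ring).
have -> : b - x ^+ (n - N) * z =
    y - x ^+ (n - N) * (z - (a : B) *: (x ^+ N : B^o)) :> B^o.
  rewrite bE mulrBr opprB addrA [y + _]addrC /GRing.scale /= mulrCA -exprD subnK //.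
apply: (submodule_overB R_ring) => //; first exact: combination_submodule.
by rewrite -[n in powers n](subnK le_Nn); exact: combination_powersXn.
Qed.

End HilbertBasis.

Section FieldImage.

Variables (k : fieldType) (A : pzRingType) (iota : {rmorphism k -> A}).

Definition scalars (a : A) : Prop := exists c, iota c = a.

Lemma scalars_ring : is_subring scalars.
Proof.
split; first by exists 1; rewrite rmorph1.
  by move=> _ _ [c <-] [c' <-]; exists (c - c'); rewrite rmorphB.
by move=> _ _ [c <-] [c' <-]; exists (c * c'); rewrite rmorphM.
Qed.

Lemma scalars_noetherian : noetherian scalars.
Proof.
move=> J [J0 JD JZ] J_scal.
(* An ideal of a field is generated by any nonzero element, or by none. *)
have [[c [Jc c0]] | J_triv] := pselect (exists c, J (iota c) /\ c != 0).
  exists [:: (iota c : A^o)]; split=> [x | x Jx].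
    by rewrite inE => /eqP ->.
  have [c' <-] := J_scal x Jx; exists (iota (c' / c)), 0; split=> //.
    by exists (c' / c).
  by rewrite addr0 /GRing.scale /= -rmorphM divfK.
exists [::]; split=> // x Jx; have [c cx] := J_scal x Jx.
have [c0 | c0] := eqVneq c 0; first by rewrite /= -cx c0 rmorph0.
by case: J_triv; exists c; rewrite cx.
Qed.

End FieldImage.

Definition left_noetherian (A : pzRingType) : Prop := noetherian (fun _ : A => True).

Lemma top_ring (A : pzRingType) : is_subring (fun _ : A => True). Proof. by []. Qed.

Lemma finite_dimensional_noetherian (k : fieldType) (A : pzRingType)
    (iota : {rmorphism k -> A}) : finite_dimensional iota -> left_noetherian A.
Proof.
move=> [n [e e_span]] J [J0 JD JZ] _.
have J_sub : submodule_over (scalars iota) J by split=> // a x _; exact: JZ.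
have [|t [tJ t_gen]] := noetherian_module (scalars_ring iota)
  (s := [seq (e i : A^o) | i <- index_enum 'I_n]) (@scalars_noetherian _ _ iota) J_sub.
  move=> x _; have [c ->] := e_span x.
  by apply: (@combination_sum _ _ A^o) => i; exists (c i).
by exists t; split=> // x /t_gen; exact: combination_mono.
Qed.

Lemma finite_type_noetherian (k : fieldType) (B : comPzRingType)
    (beta : {rmorphism k -> B}) : finite_type beta -> left_noetherian B.
Proof.
move=> [s sP]; pose R := foldr (fun x R => adjoined R x) (scalars beta) s.
have R_noeth : is_subring R /\ noetherian R.
  rewrite /R {sP R}; elim: s => [|x s [IHr IHn]] /=.
    by split; [exact: scalars_ring | exact: scalars_noetherian].
  by split; [exact: adjoined_ring | exact: noetherian_adjoined].
have [R_ring {}R_noeth] := R_noeth.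
suff RT b : R b.
  have RE : (fun _ : B => True) = R by apply: funext => b; apply/propext; split.
  rewrite /left_noetherian RE.
  exact: R_noeth.
have sub_r r c : scalars beta c -> foldr (fun x R => adjoined R x) (scalars beta) r c.
  move=> sc; elim: r => //= x r IHr; apply: subring_adjoined IHr.
apply: sP => [c | x y | x y | x].
- by apply: sub_r; exists c.
- exact: subringD.
- exact: subringM.
rewrite /R {R R_ring R_noeth}; elim: s => //= y s IHs; rewrite inE => /orP [/eqP -> | /IHs].
  apply: adjoined_gen; elim: s {IHs} => [|z s IHs] /=; first exact: scalars_ring.
  exact: adjoined_ring.
exact: subring_adjoined.
Qed.

(** An ideal of the localization is generated by its preimage, the denominators being
    units. *)
Lemma localization_noetherian (B : comPzRingType) (A : pzRingType) (S : B -> Prop)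
    (phi : {rmorphism B -> A}) :
  commutative_ring A -> is_localization S phi -> left_noetherian B ->
  left_noetherian A.
Proof.
move=> A_comm [S_unit A_frac _] B_noeth J [J0 JD JZ] _.
have [|//|s [sJ s_gen]] := B_noeth (fun b => J (phi b)).
  split=> [|x y|a x _ Jx]; first by rewrite rmorph0.
    by rewrite rmorphD; exact: JD.
  by rewrite /GRing.scale /= rmorphM; exact: JZ.
exists [seq (phi b : A^o) | b <- s]; split=> [_ /mapP [b sb ->] | x Jx].
  exact: sJ.
have [b [t [St xt]]] := A_frac x; have [v tv] := S_unit t St.
have : J (phi b) by rewrite -xt A_comm; exact: JZ.
move=> /s_gen sb; have -> : x = v *: (phi b : A^o).
  by rewrite -xt /GRing.scale /= A_comm -mulrA tv mulr1.
have [_ _ sZ] := combination_submodule (top_ring A) [seq (phi b : A^o) | b <- s].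
apply: sZ => //; elim: (s) (b) sb => [|e s' IHs] c /= => [-> | [a [y [_ sy ->]]]].
  exact: rmorph0.
exists (phi a), (phi y); split=> //; first exact: IHs.
by rewrite rmorphD /GRing.scale /= rmorphM.
Qed.

(** * Finitely generated modules over a Noetherian ring *)

Section FinitelyGenerated.

Variable A : pzRingType.

Lemma fg_of_combination (M : lmodType A) (s : seq M) :
  (forall x, combination (fun _ => True) s x) -> finitely_generated M.
Proof.
move=> s_gen; exists (size s), (fun i => s`_i) => x.
exact: combination_index (s_gen x).
Qed.

Lemma fg_quotient (M N : lmodType A) (p : {linear M -> N}) :
  surjection p -> finitely_generated M -> finitely_generated N.
Proof.
move=> p_surj [n [e e_span]]; exists n, (p \o e) => y; have [x <-] := p_surj y.
have [a ->] := e_span x; exists a; rewrite linear_sum.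
by apply: eq_bigr => i _; rewrite linearZ.
Qed.

Lemma fg_submodule (M N : lmodType A) (i : {linear N -> M}) :
  left_noetherian A -> injective i -> finitely_generated M -> finitely_generated N.
Proof.
move=> A_noeth i_inj [n [e e_span]].
have N_sub : submodule_over (fun _ : A => True) (fun x => exists y, i y = x).
  split; first by exists 0; rewrite linear0.
    by move=> _ _ [x <-] [y <-]; exists (x + y); rewrite linearD.
  by move=> a _ _ [x <-]; exists (a *: x); rewrite linearZ.
have [|t [tN t_gen]] := noetherian_module (top_ring A)
  (s := [seq e j | j <- index_enum 'I_n]) A_noeth N_sub.
  by move=> x _; have [a ->] := e_span x; exact: combination_sum.
have [u tu] : exists u, t = [seq i y | y <- u].
  elim: t tN {t_gen} => [|x t IHt] tN; first by exists [::].
  have [|u ->] := IHt; first by move=> z tz; apply: tN; rewrite inE tz orbT.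
  by have [y <-] := tN x (mem_head _ _); exists (y :: u).
apply: (fg_of_combination (s := u)) => y.
have : combination (fun _ => True) t (i y) by apply: t_gen; exists y.
by rewrite tu => /combination_map [z uz /i_inj ->].
Qed.

End FinitelyGenerated.

(** * Covers by free modules, and the theorem *)

Lemma free_cover_Mod (A : pzRingType) (M : lmodType A) : all_modules A M ->
  exists (F : lmodType A) (PF : all_modules A F) (p : {linear F -> M}),
    [/\ is_projective F, surjection p &
        span (multiples (single (reg_Mod A))) (bstalk PF : Db_Mod A)].
Proof.
move=> _; have [F [e [e_free _]]] := free_module_exists A M.
have [p pe] := e_free.1 M idfun; exists F, I, p; split.
- exact: free_projective e_free.
- by move=> y; exists (e y); exact: pe.
apply: span_in; apply: (@multiples_in _ _ M (reg_Mod A)) => //.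
exact: (@free_direct_sum A (all_modules A) M F e I I e_free).
Qed.

Lemma free_cover_mod (A : pzRingType) (M : lmodType A) : fg_modules A M ->
  exists (F : lmodType A) (PF : fg_modules A F) (p : {linear F -> M}),
    [/\ is_projective F, surjection p &
        span (single (reg_mod A)) (bstalk PF : Db_mod A)].
Proof.
move=> [n [x x_span]]; have [F [e [e_free e_span]]] := free_module_exists A 'I_n.
have [p pe] := e_free.1 M x; have PF := free_finitely_generated e_span.
exists F, PF, p; split.
- exact: free_projective e_free.
- move=> y; have [a ->] := x_span y; exists (\sum_i a i *: e i).
  by rewrite linear_sum; apply: eq_bigr => i _; rewrite linearZ pe.
apply: (@span_sum _ _ n (fun=> reg_mod A)); first by move=> _; exact: span_in.
exact: (@free_direct_sum A (fg_modules A) 'I_n F e (@fg_regular A) PF e_free).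
Qed.

Theorem proposition7p4 (k : fieldType) (A : pzRingType)
    (iota : {rmorphism k -> A}) (iota_central : central_map iota)
    (A_fin : finite_dimensional iota \/
             (commutative_ring A /\ essentially_finite_type iota))
    (A_sep : forall V : lmodType A, is_simple V -> separable_center iota V)
    (d : nat) (A_gldim : gldim A = Some d) :
  [/\ forall X : Db_Mod A,
        span_iter (multiples (single (reg_Mod A))) (1 + d) X,
      forall X : Db_mod A, span_iter (single (reg_mod A)) (1 + d) X &
      enat_le (tri_dim (Db_mod A)) (gldim A)].
Proof.
have A_noeth : left_noetherian A.
  case: A_fin => [|[A_comm [B [beta [phi [S [B_fin _ S_loc _]]]]]]].
    exact: finite_dimensional_noetherian.
  exact: localization_noetherian A_comm S_loc (finite_type_noetherian B_fin).
have pd_d M := pd_le_gldim M A_gldim.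
have span_mod (X : Db_mod A) : span_iter (single (reg_mod A)) d.+1 X.
  apply: span_iter_gldim pd_d.
  - by move=> M N i; exact: fg_submodule.
  - by move=> M N p; exact: fg_quotient.
  - exact: free_cover_mod.
split=> //.
  by move=> X; apply: span_iter_gldim pd_d => //; exact: free_cover_Mod.
rewrite A_gldim /tri_dim /inf_nat; case: pselect => [ex | []] /=.
  by case: ex_minnP => m _; apply; apply/asboolP; exists (reg_mod A).
by exists d; apply/asboolP; exists (reg_mod A).
Qed.
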